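(* Let $p(z):=\dfrac{\mathrm{Li}_2(1)-\mathrm{Li}_2(e^{2\pi iz})}{2\pi iz}$, let $z_1:=2+\log(1-w(0,-2))/(2\pi i)\approx2.20541+0.345648i$, put $v:=\Im(z_1)/\Re(z_1)$ and $c:=1+iv$, and let $\mathcal Q$ be the polygonal path joining $2.01$, $2.01c$, $2.49c$ and $2.49$ in that order. Then $z_1\in\mathcal Q$ and $\Re(p(z)-p(z_1))>0$ for all $z\in\mathcal Q$ with $z\ne z_1$.
   Context: $\mathrm{Li}_2$ is the principal branch of the dilogarithm (holomorphic on $\mathbb C\setminus[1,\infty)$, $\mathrm{Li}_2(z)=\sum_{n\ge1}z^n/n^2$ for $|z|\le1$), $\log$ the principal logarithm; $w(0,-2)\approx0.968482-0.109531i$ is the unique solution of $\mathrm{Li}_2(w)-4\pi i\log w=0$. *)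

(* Defs.v *)
From Stdlib Require Import Reals Lra List.
From Coquelicot Require Import Coquelicot.
Open Scope R_scope.
Open Scope C_scope.

Definition Cexp (z : C) : C :=
  RtoC (exp (Re z)) * (cos (Im z), sin (Im z)).

(* Principal argument, with values in (-PI, PI] for z <> 0. *)
Definition Carg (z : C) : R :=
  if Rle_dec 0 (Im z) then acos (Re z / Cmod z) else (- acos (Re z / Cmod z))%R.

(* Principal logarithm; the value at 0 is a junk value. *)
Definition Clog (z : C) : C := (ln (Cmod z), Carg z).

Lemma Cexp_Clog (z : C) : z <> 0 -> Cexp (Clog z) = z.
Proof.
intros Hz.
assert (Hm : (0 < Cmod z)%R) by now apply Cmod_gt_0.
assert (Hsq : (Cmod z * Cmod z = Re z * Re z + Im z * Im z)%R).
{ unfold Cmod; rewrite sqrt_sqrt; [ unfold Re, Im; ring | nra ]. }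
assert (Hq : (-1 <= Re z / Cmod z <= 1)%R).
{ split; apply Rmult_le_reg_r with (Cmod z); trivial;
    unfold Rdiv; rewrite Rmult_assoc, Rinv_l by lra; nra. }
assert (Hs : sin (acos (Re z / Cmod z)) = (Rabs (Im z) / Cmod z)%R).
{ rewrite sin_acos by assumption.
  replace (1 - Rsqr (Re z / Cmod z))%R with (Rsqr (Im z / Cmod z)).
  - rewrite sqrt_Rsqr_abs, Rabs_div by lra; now rewrite (Rabs_pos_eq (Cmod z)) by lra.
  - unfold Rsqr; apply Rmult_eq_reg_r with (Cmod z * Cmod z)%R; [ field_simplify | ]; nra. }
assert (Hc : cos (Carg z) = (Re z / Cmod z)%R).
{ unfold Carg; destruct (Rle_dec 0 (Im z)); rewrite ?cos_neg; now apply cos_acos. }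
assert (Hs' : sin (Carg z) = (Im z / Cmod z)%R).
{ unfold Carg; destruct (Rle_dec 0 (Im z)); rewrite ?sin_neg, Hs.
  - now rewrite Rabs_pos_eq.
  - rewrite Rabs_left by lra; field; lra. }
unfold Cexp, Clog; simpl Re; simpl Im.
rewrite exp_ln, Hc, Hs' by assumption.
destruct z as [x y]; simpl Re in *; simpl Im in *.
unfold Cmult, RtoC; simpl; f_equal; field; lra.
Qed.

Lemma Carg_bounds (z : C) : z <> 0 -> (- PI < Carg z <= PI)%R.
Proof.
intros Hz; generalize (acos_bound (Re z / Cmod z)) PI_RGT_0; intros Hb Hpi.
unfold Carg; destruct (Rle_dec 0 (Im z)) as [Hi|Hi]; [ lra | ].
split; [ | lra ].
destruct (Req_dec (acos (Re z / Cmod z)) PI) as [He|He]; [ | lra ].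
exfalso.
assert (Ha : Carg z = (- PI)%R).
{ unfold Carg; destruct (Rle_dec 0 (Im z)); [ tauto | now rewrite He ]. }
assert (Hv := Cexp_Clog z Hz).
apply (f_equal Im) in Hv.
unfold Cexp, Clog in Hv; simpl in Hv.
rewrite Ha, sin_neg, sin_PI in Hv.
apply Hi; unfold Im in *; lra.
Qed.

Definition dilog_domain (z : C) : Prop := ~ (Im z = 0%R /\ (1 <= Re z)%R).

(* The principal branch of the dilogarithm. By the identity theorem this
   determines L on dilog_domain; the second clause also fixes L 1. The values
   of L on the open cut (1, +oo) are left unconstrained. *)
Definition is_dilog (L : C -> C) : Prop :=
  (forall z : C, dilog_domain z -> @ex_derive C_AbsRing C_NormedModule L z) /\
  (forall z : C, (Cmod z <= 1)%R ->
     @is_series C_AbsRing C_NormedModule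
       (fun n : nat => z ^ S n / RtoC (INR (S n)) ^ 2) (L z)).

(* w <> 0 is needed since Clog 0 is a junk value. *)
Definition dilog_zero (L : C -> C) (w : C) : Prop :=
  dilog_domain w /\ w <> 0 /\ L w - 4 * PI * Ci * Clog w = 0.

Definition p (L : C -> C) (z : C) : C :=
  (L 1 - L (Cexp (2 * PI * Ci * z))) / (2 * PI * Ci * z).

Definition segment (a b z : C) : Prop :=
  exists t : R, (0 <= t <= 1)%R /\ z = a + t * (b - a).

Fixpoint polygonal_path (l : list C) (z : C) : Prop :=
  match l with
  | nil => False
  | a :: l' =>
      match l' with
      | nil => z = a
      | b :: _ => segment a b z \/ polygonal_path l' z
      end
  end.

(* Main.v *)
Require Import Defs.
From Stdlib Require Import Reals List Lra Lia Machin.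
From Coquelicot Require Import Coquelicot.
Import ListNotations.
Open Scope R_scope.
Open Scope C_scope.

(** Write [e(z) = exp (2 pi i z)].  By Euler's reflection formula the equation
    [Li2 w = 4 pi i log w] says that [z1] is a critical point of [p], with
    [e(z1) = 1 - w] and [p z1 = log w].

    The equation is solved by [w = exp l] with [l] a fixed point of
    [l |-> Li2 (exp l) / (4 pi i)], a contraction near the expected solution; the
    uniqueness of [w] then locates [w] to within [0.0005].

    The middle segment lies on the ray [t c] through [z1].  There the function
    [t (Re p(t c) - ln |w|)] has derivative [ln |1 - e(t c)| - ln |w|], and
    [|1 - e(t c)|] increases with [t] for [t <= 2.25] and exceeds [1 > |w|] beyond,
    so the function is positive except at [z1], where it vanishes.

    On the two vertical segments [Re p > -0.0251 >= ln |w|] follows from crude bounds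
    on the dilogarithm series, using [|Im z^n| <= n |z|^(n-1) |Im z|]. *)

(** All that is known of [L] is its series on the closed disk and bare differentiability off the
    cut; there is no integral formula to start from. Inside the unit disk the derivative
    [- log (1 - z) / z] is recovered from termwise differentiation along rays, and all calculus runs
    on curves [R -> C] through their real and imaginary parts. The point 1 lies on the cut, so
    continuity of [L] there, which fixes the constant in the reflection formula, comes from uniform
    tail bounds.

    Reflection also serves the numerics: [w] has modulus about 0.975, where the series is too slow,
    while [1 - w] has modulus about 0.114 and two terms suffice.

    The factor [t] on the ray is there because, with [k = 2 pi i c], one has
    [t p(t c) = (L 1 - L (exp (k t))) / k], whose derivative is a logarithm without any dilogarithm.
    The value 2.25 is where [e(t c)] has turned by a right angle past [t = 2]. The threshold
    [-0.0251] is the upper bound of [Re l] on the disk that contains [l = log w]. *)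

(** * Moduli, the principal logarithm and the exponential *)

Lemma C_eq (a b : C) : Re a = Re b -> Im a = Im b -> a = b.
Proof. destruct a, b; simpl; intros; now subst. Qed.

Lemma Cmod_sqr (z : C) : (Cmod z * Cmod z = Re z * Re z + Im z * Im z)%R.
Proof. generalize (Cmod2_alt z); lra. Qed.

Lemma Cmod_le_of_sqr (z : C) (r : R) :
  (0 <= r -> Re z * Re z + Im z * Im z <= r * r -> Cmod z <= r)%R.
Proof.
intros Hr H; rewrite <- Cmod_sqr in H; generalize (Cmod_ge_0 z); nra.
Qed.

Lemma im_le_Cmod (z : C) : (Rabs (Im z) <= Cmod z)%R.
Proof. apply Rle_trans with (2 := Rmax_Cmod z); apply Rmax_r. Qed.

Lemma Cmod_le_abs (z : C) : (Cmod z <= Rabs (Re z) + Rabs (Im z))%R.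
Proof.
apply Cmod_le_of_sqr.
- generalize (Rabs_pos (Re z)) (Rabs_pos (Im z)); lra.
- generalize (Rabs_pos (Re z)) (Rabs_pos (Im z)).
  intros; generalize (Rsqr_abs (Re z)) (Rsqr_abs (Im z)); unfold Rsqr; nra.
Qed.

Lemma Cmod_minus_le (a b : C) : (Cmod a - Cmod b <= Cmod (a - b))%R.
Proof.
generalize (Cmod_triangle (a - b) b).
replace (a - b + b) with a by ring; lra.
Qed.

(** In the right half-plane the case distinction on the sign of [Im z] disappears, which makes the
    argument differentiable and computable. Every logarithm that is differentiated below stays in
    this half-plane. *)
Lemma Clog_atan (z : C) :
  (0 < Re z)%R -> Clog z = (ln (Cmod z), atan (Im z / Re z)).
Proof.
intros Hz; unfold Clog; f_equal.
assert (Hm : (0 < Cmod z)%R).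
{ apply Rlt_le_trans with (1 := Hz), Rle_trans with (2 := re_le_Cmod z), Rle_abs. }
assert (Hs : (sqrt (1 - (Re z / Cmod z)²) = Rabs (Im z) / Cmod z)%R).
{ replace (1 - (Re z / Cmod z)²)%R with ((Im z / Cmod z)²).
  - rewrite sqrt_Rsqr_abs, Rabs_div by lra; now rewrite (Rabs_pos_eq (Cmod z)) by lra.
  - generalize (Cmod_sqr z); intros; unfold Rsqr.
    apply Rmult_eq_reg_r with (Cmod z * Cmod z)%R; [ field_simplify | ]; nra. }
assert (Ha : (acos (Re z / Cmod z) = atan (Rabs (Im z) / Re z))%R).
{ rewrite acos_atan, Hs by (now apply Rdiv_lt_0_compat); f_equal; field; lra. }
unfold Carg; rewrite Ha; destruct (Rle_dec 0 (Im z)) as [H|H].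
- now rewrite Rabs_pos_eq.
- rewrite Rabs_left by lra; rewrite <- atan_opp; f_equal; field; lra.
Qed.

Lemma Re_Clog_sqr (z : C) :
  z <> 0 -> Re (Clog z) = (/ 2 * ln (Re z * Re z + Im z * Im z))%R.
Proof.
intros Hz; simpl; rewrite <- Cmod_sqr.
assert (Hm := proj1 (Cmod_gt_0 z) Hz).
rewrite ln_mult by assumption; lra.
Qed.

Lemma Clog_bounds (z : C) (a : R) :
  (0 < Re z -> Cmod z <= exp a -> exp (- a) <= Cmod z ->
   Rabs (Re (Clog z)) <= a /\ Rabs (Im (Clog z)) < PI / 2)%R.
Proof.
intros Hz H1 H2; rewrite Clog_atan by assumption; simpl; split.
- assert (0 < Cmod z)%R by (generalize (exp_pos (- a)); lra).
  apply Rabs_le; split.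
  + rewrite <- (ln_exp (- a)); apply ln_le; [ apply exp_pos | assumption ].
  + rewrite <- (ln_exp a); now apply ln_le.
- apply Rabs_def1; generalize (atan_bound (Im z / Re z)); lra.
Qed.

Lemma Re_Cexp (z : C) : Re (Cexp z) = (exp (Re z) * cos (Im z))%R.
Proof. unfold Cexp; rewrite re_mult; simpl; ring. Qed.

Lemma Im_Cexp (z : C) : Im (Cexp z) = (exp (Re z) * sin (Im z))%R.
Proof. unfold Cexp; rewrite im_mult; simpl; ring. Qed.

Lemma Cmod_Cexp (z : C) : Cmod (Cexp z) = exp (Re z).
Proof.
assert (H := Cmod_sqr (Cexp z)); rewrite Re_Cexp, Im_Cexp in H.
assert (H1 := sin2_cos2 (Im z)); unfold Rsqr in H1.
assert (H2 := exp_pos (Re z)); assert (H3 := Cmod_ge_0 (Cexp z)).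
assert (H4 : (Cmod (Cexp z) * Cmod (Cexp z) = exp (Re z) * exp (Re z))%R).
{ rewrite H; replace (exp (Re z) * exp (Re z))%R with
   (exp (Re z) * exp (Re z) * (sin (Im z) * sin (Im z) + cos (Im z) * cos (Im z)))%R
   by (rewrite H1; ring); ring. }
nra.
Qed.

Lemma Cexp_neq_0 (z : C) : Cexp z <> 0.
Proof. apply Cmod_gt_0; rewrite Cmod_Cexp; apply exp_pos. Qed.

Lemma Clog_Cexp (z : C) :
  (- (PI / 2) < Im z < PI / 2)%R -> Clog (Cexp z) = z.
Proof.
intros Hz; assert (He := exp_pos (Re z)).
assert (Hc : (0 < cos (Im z))%R) by (apply cos_gt_0; lra).
rewrite Clog_atan by (rewrite Re_Cexp; now apply Rmult_lt_0_compat).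
rewrite Cmod_Cexp, ln_exp, Re_Cexp, Im_Cexp.
replace (exp (Re z) * sin (Im z) / (exp (Re z) * cos (Im z)))%R with (tan (Im z))
  by (unfold tan; field; lra).
rewrite atan_tan by lra; now destruct z.
Qed.

(** * Derivatives along real curves in the complex plane *)

(** Two real derivatives rather than one complex-valued one, so that real calculus, the mean value
    theorem and real power series apply to each component. *)
Definition dpath (g : R -> C) (s : R) (l : C) : Prop :=
  is_derive (fun t => Re (g t)) s (Re l) /\ is_derive (fun t => Im (g t)) s (Im l).

Lemma is_derive_eps (f : R -> R) (s l : R) :
  is_derive f s l <->
  forall eps : R, (0 < eps)%R -> exists d : R, (0 < d)%R /\
    forall h : R, (Rabs h < d)%R ->
      (Rabs (f (s + h) - f s - h * l) <= eps * Rabs h)%R.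
Proof.
rewrite is_derive_Reals; split; intros H eps Heps.
- destruct (H eps Heps) as [d Hd]; exists d; split; [ apply cond_pos | intros h Hh ].
  destruct (Req_dec h 0) as [H0|H0].
  + subst; rewrite Rplus_0_r; rewrite Rabs_R0, Rmult_0_r.
    replace (f s - f s - 0 * l)%R with 0%R by ring; rewrite Rabs_R0; lra.
  + specialize (Hd h H0 Hh).
    replace (f (s + h) - f s - h * l)%R with (((f (s + h) - f s) / h - l) * h)%R
      by (field; assumption).
    rewrite Rabs_mult; apply Rmult_le_compat_r; [ apply Rabs_pos | lra ].
- destruct (H (eps / 2)%R) as [d [Hd H']]; [ lra | ].
  exists (mkposreal d Hd); intros h H0 Hh; simpl in Hh.
  specialize (H' h Hh); assert (Ha := Rabs_pos_lt h H0).
  replace ((f (s + h) - f s) / h - l)%R with ((f (s + h) - f s - h * l) / h)%R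
    by (field; assumption).
  rewrite Rabs_div by assumption.
  apply Rle_lt_trans with (eps / 2)%R; [ | lra ].
  apply Rmult_le_reg_r with (Rabs h); trivial.
  unfold Rdiv at 1; rewrite Rmult_assoc, Rinv_l; lra.
Qed.

(** The two components amount to one first-order expansion in the complex norm, the form that
    composes with a complex derivative. *)
Lemma dpath_eps (g : R -> C) (s : R) (l : C) :
  dpath g s l <->
  forall eps : R, (0 < eps)%R -> exists d : R, (0 < d)%R /\
    forall h : R, (Rabs h < d)%R -> (Cmod (g (s + h)%R - g s - h * l) <= eps * Rabs h)%R.
Proof.
assert (HR : forall h : R, Re (g (s + h)%R - g s - h * l)
   = (Re (g (s + h)%R) - Re (g s) - h * Re l)%R) by (intros; unfold Re, Im; simpl; ring).
assert (HI : forall h : R, Im (g (s + h)%R - g s - h * l)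
   = (Im (g (s + h)%R) - Im (g s) - h * Im l)%R) by (intros; unfold Re, Im; simpl; ring).
split.
- intros [H1 H2] eps Heps.
  apply is_derive_eps with (eps := (eps / 2)%R) in H1; [ | lra ].
  apply is_derive_eps with (eps := (eps / 2)%R) in H2; [ | lra ].
  destruct H1 as [d1 [Hd1 H1]], H2 as [d2 [Hd2 H2]].
  exists (Rmin d1 d2); split; [ now apply Rmin_glb_lt | intros h Hh ].
  assert (Rmin d1 d2 <= d1)%R by apply Rmin_l.
  assert (Rmin d1 d2 <= d2)%R by apply Rmin_r.
  apply Rle_trans with (1 := Cmod_le_abs _); rewrite HR, HI.
  specialize (H1 h ltac:(lra)); specialize (H2 h ltac:(lra)); lra.
- intros H; split; apply is_derive_eps; intros eps Heps;
    destruct (H eps Heps) as [d [Hd H']]; exists d; split; trivial;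
    intros h Hh; apply Rle_trans with (2 := H' h Hh).
  + rewrite <- HR; apply re_le_Cmod.
  + rewrite <- HI; apply im_le_Cmod.
Qed.

Lemma is_derive_C_eps (L : C -> C) (z l : C) :
  @is_derive C_AbsRing C_NormedModule L z l ->
  forall eps : R, (0 < eps)%R -> exists d : R, (0 < d)%R /\
    forall y : C, (Cmod (y - z) < d)%R ->
      (Cmod (L y - L z - (y - z) * l) <= eps * Cmod (y - z))%R.
Proof.
intros [_ H] eps Heps.
destruct (H z (fun P HP => HP) (mkposreal eps Heps)) as [d Hd].
exists d; split; [ apply cond_pos | intros y Hy ].
exact (Hd y Hy).
Qed.

Lemma dpath_comp (L : C -> C) (g : R -> C) (s : R) (l l' : C) :
  @is_derive C_AbsRing C_NormedModule L (g s) l -> dpath g s l' ->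
  dpath (fun t => L (g t)) s (l * l').
Proof.
intros HL Hg; apply dpath_eps; intros eps Heps.
assert (HM : (0 < Cmod l' + 1)%R) by (generalize (Cmod_ge_0 l'); lra).
assert (HN : (0 < Cmod l + 1)%R) by (generalize (Cmod_ge_0 l); lra).
assert (He1 : (0 < eps / 2 / (Cmod l' + 1))%R) by (apply Rdiv_lt_0_compat; lra).
destruct (is_derive_C_eps _ _ _ HL _ He1) as [d1 [Hd1 H1]].
rewrite dpath_eps in Hg.
(* The bound 1 gives [g] linear growth with slope [Cmod l' + 1]; the other bound makes the error of
   [g], multiplied by [l], at most half of [eps * Rabs h]. *)
set (e2 := Rmin 1 (eps / 2 / (Cmod l + 1))).
assert (He2 : (0 < e2)%R) by (apply Rmin_glb_lt; [ lra | apply Rdiv_lt_0_compat; lra ]).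
destruct (Hg e2 He2) as [d2 [Hd2 H2]].
assert (He2a : (e2 <= 1)%R) by apply Rmin_l.
assert (He2b : (e2 * (Cmod l + 1) <= eps / 2)%R).
{ apply Rle_trans with (eps / 2 / (Cmod l + 1) * (Cmod l + 1))%R.
  - apply Rmult_le_compat_r; [ lra | apply Rmin_r ].
  - right; field; lra. }
exists (Rmin d2 (d1 / (Cmod l' + 1))); split.
{ apply Rmin_glb_lt; trivial; now apply Rdiv_lt_0_compat. }
intros h Hh.
assert (Hh1 : (Rabs h < d2)%R) by (apply Rlt_le_trans with (1 := Hh); apply Rmin_l).
assert (Hh2 : (Rabs h * (Cmod l' + 1) < d1)%R).
{ apply Rlt_le_trans with (d1 / (Cmod l' + 1) * (Cmod l' + 1))%R.
  - apply Rmult_lt_compat_r; trivial; apply Rlt_le_trans with (1 := Hh); apply Rmin_r.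
  - right; field; lra. }
specialize (H2 h Hh1).
assert (Hp := Rabs_pos h).
assert (HD : (Cmod (g (s + h)%R - g s) <= Rabs h * (Cmod l' + 1))%R).
{ generalize (Cmod_triangle (g (s + h)%R - g s - h * l') (h * l')).
  replace (g (s + h)%R - g s - h * l' + h * l') with (g (s + h)%R - g s) by ring.
  rewrite Cmod_mult, Cmod_R; nra. }
specialize (H1 (g (s + h)%R) ltac:(lra)).
replace (L (g (s + h)%R) - L (g s) - h * (l * l')) with
  ((L (g (s + h)%R) - L (g s) - (g (s + h)%R - g s) * l)
   + (g (s + h)%R - g s - h * l') * l) by ring.
apply Rle_trans with (1 := Cmod_triangle _ _).
rewrite (Cmod_mult (_ - _)).
assert (Ha : (Cmod (L (g (s + h)%R) - L (g s) - (g (s + h)%R - g s) * l)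
   <= eps / 2 * Rabs h)%R).
{ apply Rle_trans with (1 := H1).
  apply Rle_trans with (eps / 2 / (Cmod l' + 1) * (Rabs h * (Cmod l' + 1)))%R.
  - apply Rmult_le_compat_l; lra.
  - right; field; lra. }
generalize (Cmod_ge_0 l) (Cmod_ge_0 (g (s + h)%R - g s - h * l')); intros.
assert (Cmod (g (s + h)%R - g s - h * l') * Cmod l <= e2 * Rabs h * (Cmod l + 1))%R
  by (apply Rmult_le_compat; lra).
nra.
Qed.

Lemma dpath_const (a : C) (s : R) : dpath (fun _ => a) s 0.
Proof. split; simpl; apply @is_derive_const. Qed.

Lemma dpath_line (a b : C) (s : R) : dpath (fun t => a + t * b) s b.
Proof. destruct a, b; split; simpl; auto_derive; trivial; ring. Qed.

Lemma dpath_ext (f g : R -> C) (s : R) (l : C) :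
  (forall t, f t = g t) -> dpath f s l -> dpath g s l.
Proof.
intros H [H1 H2]; split; (eapply is_derive_ext; [ | eassumption ]);
  intros t; simpl; now rewrite H.
Qed.

Lemma dpath_plus (f g : R -> C) (s : R) (a b : C) :
  dpath f s a -> dpath g s b -> dpath (fun t => f t + g t) s (a + b).
Proof. intros [H1 H2] [H3 H4]; split; simpl; apply @is_derive_plus; assumption. Qed.

Lemma dpath_mult (f g : R -> C) (s : R) (a b : C) :
  dpath f s a -> dpath g s b -> dpath (fun t => f t * g t) s (a * g s + f s * b).
Proof.
intros [H1 H2] [H3 H4]; split.
- apply is_derive_ext with (fun t => Re (f t) * Re (g t) - Im (f t) * Im (g t))%R;
    [ reflexivity | ].
  replace (Re (a * g s + f s * b)) with
    (minus (plus (mult (Re a) (Re (g s))) (mult (Re (f s)) (Re b)))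
      (plus (mult (Im a) (Im (g s))) (mult (Im (f s)) (Im b))))
    by (unfold minus, plus, opp, mult, Re, Im; simpl; ring).
  apply @is_derive_minus; apply @is_derive_mult; trivial; intros; apply Rmult_comm.
- apply is_derive_ext with (fun t => Re (f t) * Im (g t) + Im (f t) * Re (g t))%R;
    [ reflexivity | ].
  replace (Im (a * g s + f s * b)) with
    (plus (plus (mult (Re a) (Im (g s))) (mult (Re (f s)) (Im b)))
      (plus (mult (Im a) (Re (g s))) (mult (Im (f s)) (Re b))))
    by (unfold minus, plus, opp, mult, Re, Im; simpl; ring).
  apply @is_derive_plus; apply @is_derive_mult; trivial; intros; apply Rmult_comm.
Qed.

Lemma dpath_scal (k : C) (g : R -> C) (s : R) (l : C) :
  dpath g s l -> dpath (fun t => k * g t) s (k * l).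
Proof.
intros H; replace (k * l) with (0 * g s + k * l) by ring.
apply dpath_mult; trivial; apply dpath_const.
Qed.

(** This and the next three lemmas are the component formulas for the complex exponential and
    logarithm, with the real and imaginary parts of the curve kept as abstract functions [a] and
    [b]. *)
Lemma is_derive_exp_cos (a b : R -> R) (s da db : R) :
  is_derive a s da -> is_derive b s db ->
  is_derive (fun t => exp (a t) * cos (b t))%R s
    (da * (exp (a s) * cos (b s)) - db * (exp (a s) * sin (b s)))%R.
Proof.
intros H1 H2; auto_derive; [ repeat split; eexists; eassumption | ].
rewrite (is_derive_unique (fun x : R => a x) _ _ H1),
  (is_derive_unique (fun x : R => b x) _ _ H2); ring.
Qed.

Lemma is_derive_exp_sin (a b : R -> R) (s da db : R) :
  is_derive a s da -> is_derive b s db ->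
  is_derive (fun t => exp (a t) * sin (b t))%R s
    (da * (exp (a s) * sin (b s)) + db * (exp (a s) * cos (b s)))%R.
Proof.
intros H1 H2; auto_derive; [ repeat split; eexists; eassumption | ].
rewrite (is_derive_unique (fun x : R => a x) _ _ H1),
  (is_derive_unique (fun x : R => b x) _ _ H2); ring.
Qed.

Lemma is_derive_half_ln_sqr (a b : R -> R) (s da db : R) :
  (0 < a s)%R -> is_derive a s da -> is_derive b s db ->
  is_derive (fun t => / 2 * ln (a t * a t + b t * b t))%R s
    ((da * a s + db * b s) / (a s * a s + b s * b s))%R.
Proof.
intros H0 H1 H2; auto_derive; [ repeat split; try (eexists; eassumption); nra | ].
rewrite (is_derive_unique (fun x : R => a x) _ _ H1),
  (is_derive_unique (fun x : R => b x) _ _ H2); field; nra.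
Qed.

Lemma is_derive_atan_div (a b : R -> R) (s da db : R) :
  (0 < a s)%R -> is_derive a s da -> is_derive b s db ->
  is_derive (fun t => atan (b t / a t)) s
    ((db * a s - da * b s) / (a s * a s + b s * b s))%R.
Proof.
intros H0 H1 H2; auto_derive; [ repeat split; try (eexists; eassumption); lra | ].
rewrite (is_derive_unique (fun x : R => a x) _ _ H1),
  (is_derive_unique (fun x : R => b x) _ _ H2).
unfold Rsqr; field; repeat split; nra.
Qed.

Lemma dpath_Cexp (g : R -> C) (s : R) (l : C) :
  dpath g s l -> dpath (fun t => Cexp (g t)) s (l * Cexp (g s)).
Proof.
intros [H1 H2]; split; rewrite ?re_mult, ?im_mult, Re_Cexp, Im_Cexp.
- apply is_derive_ext with (fun t => exp (Re (g t)) * cos (Im (g t)))%R;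
    [ intros; now rewrite Re_Cexp | ].
  now apply (is_derive_exp_cos (fun t => Re (g t)) (fun t => Im (g t))).
- apply is_derive_ext with (fun t => exp (Re (g t)) * sin (Im (g t)))%R;
    [ intros; now rewrite Im_Cexp | ].
  now apply (is_derive_exp_sin (fun t => Re (g t)) (fun t => Im (g t))).
Qed.

(** The half-plane is open and [g] is continuous at [s], so near [s] the logarithm may be replaced
    by its formula in [ln] and [atan]. *)
Lemma dpath_Clog (g : R -> C) (s : R) (l : C) :
  (0 < Re (g s))%R -> dpath g s l -> dpath (fun t => Clog (g t)) s (l / g s).
Proof.
intros Hp [H1 H2].
assert (Hl : locally s (fun t => (0 < Re (g t))%R)).
{ assert (Hc : continuous (fun t => Re (g t)) s)
    by (apply @ex_derive_continuous; eexists; eassumption).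
  apply (Hc (fun x => (0 < x)%R)).
  exists (mkposreal _ Hp); intros y Hy.
  unfold ball in Hy; simpl in Hy; unfold AbsRing_ball, abs, minus, plus, opp in Hy; simpl in Hy.
  apply Rabs_def2 in Hy; lra. }
assert (Hq : (Re (g s) * Re (g s) + Im (g s) * Im (g s) <> 0)%R) by nra.
assert (Hd : Re (l / g s) = ((Re l * Re (g s) + Im l * Im (g s))
    / (Re (g s) * Re (g s) + Im (g s) * Im (g s)))%R /\
   Im (l / g s) = ((Im l * Re (g s) - Re l * Im (g s))
    / (Re (g s) * Re (g s) + Im (g s) * Im (g s)))%R).
{ unfold Cdiv; rewrite re_mult, im_mult; unfold Re, Im in *; simpl; split; field;
    simpl in *; lra. }
destruct Hd as [Hd1 Hd2]; split.
- apply is_derive_ext_loc with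
    (fun t => / 2 * ln (Re (g t) * Re (g t) + Im (g t) * Im (g t)))%R.
  { apply filter_imp with (2 := Hl); intros t Ht.
    rewrite Re_Clog_sqr; trivial; intros H0; rewrite H0 in Ht; simpl in Ht; lra. }
  rewrite Hd1; now apply (is_derive_half_ln_sqr (fun t => Re (g t)) (fun t => Im (g t))).
- apply is_derive_ext_loc with (fun t => atan (Im (g t) / Re (g t))).
  { apply filter_imp with (2 := Hl); intros t Ht; now rewrite Clog_atan. }
  rewrite Hd2; now apply (is_derive_atan_div (fun t => Re (g t)) (fun t => Im (g t))).
Qed.

(* Mean value inequality: apply the real mean value theorem to the component of
   the curve in the direction of the total increment. *)
Lemma dpath_mvt (g : R -> C) (dg : R -> C) (k : R) :
  (forall s, (0 <= s <= 1)%R -> dpath g s (dg s)) ->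
  (forall s, (0 <= s <= 1)%R -> (Cmod (dg s) <= k)%R) ->
  (Cmod (g 1%R - g 0%R) <= k)%R.
Proof.
intros H Hk.
set (d := g 1%R - g 0%R).
set (f := fun t => (Re d * Re (g t) + Im d * Im (g t))%R).
assert (Hf : forall x, (0 <= x <= 1)%R ->
  is_derive f x (Re d * Re (dg x) + Im d * Im (dg x))%R).
{ intros x Hx; destruct (H x Hx) as [H1 H2].
  apply @is_derive_plus; apply @is_derive_scal; assumption. }
destruct (MVT_gen f 0 1 (fun t => Re d * Re (dg t) + Im d * Im (dg t))%R)
  as [c [Hc Heq]].
- rewrite Rmin_left, Rmax_right by lra; intros x Hx; apply Hf; lra.
- rewrite Rmin_left, Rmax_right by lra; intros x Hx.
  apply continuity_pt_filterlim, @ex_derive_continuous; eexists; now apply Hf.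
- rewrite Rmin_left, Rmax_right in Hc by lra.
  assert (Hd : (Cmod d * Cmod d <= Cmod d * Cmod (dg c))%R).
  { rewrite Cmod_sqr.
    replace (Re d * Re d + Im d * Im d)%R with (f 1 - f 0)%R
      by (unfold f, d, Re, Im; simpl; ring).
    rewrite Heq.
    replace ((Re d * Re (dg c) + Im d * Im (dg c)) * (1 - 0))%R
      with (Re (Cconj d * dg c)) by (unfold Re, Im; simpl; ring).
    apply Rle_trans with (1 := Rle_abs _), Rle_trans with (1 := re_le_Cmod _).
    rewrite Cmod_mult, Cmod_conj; lra. }
  specialize (Hk c Hc); generalize (Cmod_ge_0 d) (Cmod_ge_0 (dg c)); nra.
Qed.

(** * Partial sums and tails of the dilogarithm series *)

(** Indexed by the number of terms, so that the empty sum is available. *)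
Fixpoint li2_partial (z : C) (n : nat) : C :=
  match n with
  | O => 0
  | S m => li2_partial z m + z ^ S m / RtoC (INR (S m)) ^ 2
  end.

Lemma sum_n_li2_partial (z : C) (n : nat) :
  sum_n (fun k : nat => z ^ S k / RtoC (INR (S k)) ^ 2) n = li2_partial z (S n).
Proof.
induction n as [|n IH].
- rewrite sum_O; exact (eq_sym (Cplus_0_l _)).
- rewrite sum_Sn, IH; reflexivity.
Qed.

Lemma INR_S_neq_0 (n : nat) : RtoC (INR (S n)) <> 0.
Proof. intros H; apply RtoC_inj in H; exact (not_0_INR (S n) (Nat.neq_succ_0 n) H). Qed.

Lemma Cdiv_INR_sqr (z : C) (n : nat) :
  z / RtoC (INR (S n)) ^ 2 = RtoC (/ (INR (S n) * INR (S n))) * z.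
Proof.
assert (H := not_0_INR (S n) (Nat.neq_succ_0 n)).
rewrite RtoC_inv, RtoC_mult by nra.
field; exact (INR_S_neq_0 n).
Qed.

Lemma Cmod_li2_term (z : C) (n : nat) :
  Cmod (z ^ S n / RtoC (INR (S n)) ^ 2) = (Cmod z ^ S n / (INR (S n) * INR (S n)))%R.
Proof.
assert (H := INR_S_neq_0 n).
rewrite Cmod_div, !Cmod_pow, Cmod_R by (now apply Cpow_nz).
rewrite Rabs_pos_eq by apply pos_INR; f_equal; ring.
Qed.

Lemma pow_le_1 (r : R) (n : nat) : (0 <= r <= 1 -> 0 <= r ^ n <= 1)%R.
Proof. intros H; induction n as [|n IH]; simpl; nra. Qed.

(** Telescoping: [(k + 1/2) (k + 3/2) <= (k + 1)^2], hence [1 / (k + 1)^2 <= 1 / (k + 1/2) - 1 / (k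
    + 3/2)]. The powers of [Cmod z] are bounded by the first one of the tail. *)
Lemma li2_partial_tail (z : C) (N M : nat) : (Cmod z <= 1)%R ->
  (Cmod (li2_partial z (N + M) - li2_partial z N)
   <= Cmod z ^ S N * (/ (INR N + / 2) - / (INR (N + M) + / 2)))%R.
Proof.
intros Hz; assert (Hz0 := Cmod_ge_0 z).
induction M as [|M IH].
- rewrite Nat.add_0_r, Rminus_diag, Rmult_0_r.
  replace (li2_partial z N - li2_partial z N) with (RtoC 0) by ring.
  rewrite Cmod_0; lra.
- rewrite Nat.add_succ_r; cbn [li2_partial].
  set (k := (N + M)%nat) in *.
  replace (li2_partial z k + z ^ S k / RtoC (INR (S k)) ^ 2 - li2_partial z N) with
    ((li2_partial z k - li2_partial z N) + z ^ S k / RtoC (INR (S k)) ^ 2) by ring.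
  apply Rle_trans with (1 := Cmod_triangle _ _).
  rewrite Cmod_li2_term.
  assert (Hk := pos_INR k).
  assert (H1 : (Cmod z ^ S k / (INR (S k) * INR (S k))
    <= Cmod z ^ S N * (/ (INR k + / 2) - / (INR (S k) + / 2)))%R).
  { rewrite S_INR; apply Rmult_le_compat.
    - apply pow_le; assumption.
    - left; apply Rinv_0_lt_compat; nra.
    - unfold k; replace (S (N + M)) with (S N + M)%nat by lia; rewrite pow_add.
      assert (H1 := pow_le_1 (Cmod z) M (conj Hz0 Hz)).
      assert (H2 := pow_le (Cmod z) (S N) Hz0); nra.
    - replace (/ (INR k + / 2) - / (INR k + 1 + / 2))%R with
        (/ ((INR k + / 2) * (INR k + 1 + / 2)))%R by (field; lra).
      apply Rinv_le_contravar; nra. }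
  lra.
Qed.

(** Balls of [C_UniformSpace] are products of real balls; hence the halved radius. *)
Lemma is_series_C_eps (a : nat -> C) (l : C) :
  @is_series C_AbsRing C_NormedModule a l ->
  forall eps : R, (0 < eps)%R -> exists N : nat, forall n : nat, (N <= n)%nat ->
    (Cmod (l - sum_n a n) <= eps)%R.
Proof.
intros H eps Heps; assert (He : (0 < eps / 2)%R) by lra.
assert (Hb : forall y : C, @ball C_UniformSpace l (eps / 2) y -> (Cmod (l - y) <= eps)%R).
{ intros y [H1 H2].
  unfold ball in H1, H2; simpl in H1, H2.
  unfold AbsRing_ball, abs, minus, plus, opp in H1, H2; simpl in H1, H2.
  apply Rabs_def2 in H1, H2.
  apply Rle_trans with (1 := Cmod_le_abs _).
  assert (Rabs (Re (l - y)) <= eps / 2)%R by (apply Rabs_le; unfold Re; simpl; lra).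
  assert (Rabs (Im (l - y)) <= eps / 2)%R by (apply Rabs_le; unfold Im; simpl; lra).
  lra. }
destruct (proj1 (filterlim_locally _ _) H (mkposreal _ He)) as [N HN].
exists N; intros n Hn; exact (Hb _ (HN n Hn)).
Qed.

(** The limit of the finite tail estimate. It includes the unit circle, which matters at [z = 1] and
    at the real ends of the vertical segments. *)
Lemma dilog_tail (L : C -> C) (hL : is_dilog L) (z : C) (N : nat) :
  (Cmod z <= 1)%R ->
  (Cmod (L z - li2_partial z N) <= Cmod z ^ S N / (INR N + / 2))%R.
Proof.
intros Hz; apply Rnot_lt_le; intros Hlt.
set (B := (Cmod z ^ S N / (INR N + / 2))%R) in *.
set (A := Cmod (L z - li2_partial z N)) in *.
destruct (is_series_C_eps _ _ (proj2 hL z Hz) ((A - B) / 2)%R ltac:(lra)) as [n0 H].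
specialize (H (N + n0)%nat ltac:(lia)); rewrite sum_n_li2_partial in H.
replace (S (N + n0)) with (N + S n0)%nat in H by lia.
assert (H1 := li2_partial_tail z N (S n0) Hz).
assert (H2 := Cmod_triangle (L z - li2_partial z (N + S n0))
   (li2_partial z (N + S n0) - li2_partial z N)).
replace (L z - li2_partial z (N + S n0) + (li2_partial z (N + S n0) - li2_partial z N))
  with (L z - li2_partial z N) in H2 by ring.
fold A in H2.
assert (H3 : (0 <= Cmod z ^ S N * / (INR (N + S n0) + / 2))%R).
{ apply Rmult_le_pos; [ apply pow_le, Cmod_ge_0 | ].
  left; apply Rinv_0_lt_compat; generalize (pos_INR (N + S n0)); lra. }
unfold B, Rdiv in *; lra.
Qed.

(** The tail bound after zero terms. *)
Lemma dilog_norm_le (L : C -> C) (hL : is_dilog L) (z : C) :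
  (Cmod z <= 1)%R -> (Cmod (L z) <= 2 * Cmod z)%R.
Proof.
intros Hz; generalize (dilog_tail L hL z 0 Hz); simpl.
replace (L z - 0) with (L z) by ring; lra.
Qed.

Lemma Im_li2_partial_1 (n : nat) : Im (li2_partial 1 n) = 0%R.
Proof.
induction n as [|n IH]; [ reflexivity | cbn [li2_partial] ].
rewrite Cpow_1_l, Cdiv_INR_sqr, Cmult_1_r.
change (Im (li2_partial 1 n) + 0 = 0)%R; lra.
Qed.

(** Telescoping from below: [(n + 5/8) (n + 13/8) >= (n + 1)^2] for every [n >= 0]. *)
Lemma li2_partial_1_lower (N M : nat) :
  (/ (INR N + 5 / 8) - / (INR (N + M) + 5 / 8)
   <= Re (li2_partial 1 (N + M)) - Re (li2_partial 1 N))%R.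
Proof.
induction M as [|M IH]; [ rewrite Nat.add_0_r; lra | ].
rewrite Nat.add_succ_r; cbn [li2_partial].
set (n := (N + M)%nat) in *.
assert (E : 1 ^ S n / RtoC (INR (S n)) ^ 2 = RtoC (/ (INR (S n) * INR (S n)))).
{ rewrite Cpow_1_l, Cdiv_INR_sqr; ring. }
rewrite E.
change (/ (INR N + 5 / 8) - / (INR (S n) + 5 / 8)
    <= Re (li2_partial 1 n) + / (INR (S n) * INR (S n)) - Re (li2_partial 1 N))%R.
rewrite S_INR; assert (Hn := pos_INR n).
assert (/ (INR n + 5 / 8) - / (INR n + 1 + 5 / 8)
    <= / ((INR n + 1) * (INR n + 1)))%R; [ | lra ].
replace (/ (INR n + 5 / 8) - / (INR n + 1 + 5 / 8))%R with
    (/ ((INR n + 5 / 8) * (INR n + 1 + 5 / 8)))%R by (field; lra).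
apply Rinv_le_contravar; nra.
Qed.

Lemma Im_Cpow_le (z : C) (n : nat) :
  (Rabs (Im (z ^ S n)) <= INR (S n) * Cmod z ^ n * Rabs (Im z))%R.
Proof.
induction n as [|n IH].
- rewrite Cpow_1_r; simpl; lra.
- rewrite Cpow_S, im_mult, S_INR.
  apply Rle_trans with (1 := Rabs_triang _ _); rewrite !Rabs_mult.
  assert (H1 := re_le_Cmod z).
  assert (H2 := re_le_Cmod (z ^ S n)); rewrite Cmod_pow in H2.
  assert (H3 := Rabs_pos (Im z)); assert (H4 := Rabs_pos (Re z)).
  assert (H5 := Rabs_pos (Im (z ^ S n))); assert (H6 := Rabs_pos (Re (z ^ S n))).
  assert (H7 : (Rabs (Re z) * Rabs (Im (z ^ S n))
    <= Cmod z * (INR (S n) * Cmod z ^ n * Rabs (Im z)))%R)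
    by (apply Rmult_le_compat; assumption).
  assert (H8 : (Rabs (Im z) * Rabs (Re (z ^ S n)) <= Rabs (Im z) * Cmod z ^ S n)%R)
    by (apply Rmult_le_compat_l; assumption).
  cbn [pow] in *; lra.
Qed.

(** [r * log_partial r n] is the partial sum of [- ln (1 - r)]; at [r = 1] it is the harmonic sum.
    It arises by dividing the bound [n r^(n-1)] for the powers by [n^2]. *)
Fixpoint log_partial (r : R) (n : nat) : R :=
  match n with
  | O => 0
  | S m => log_partial r m + r ^ m / INR (S m)
  end.

Lemma Im_li2_partial_le (z : C) (n : nat) :
  (Rabs (Im (li2_partial z n)) <= Rabs (Im z) * log_partial (Cmod z) n)%R.
Proof.
induction n as [|n IH]; cbn [li2_partial log_partial].
- simpl; rewrite Rabs_R0; lra.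
- assert (Hn : (0 < INR (S n))%R) by apply lt_0_INR, Nat.lt_0_succ.
  rewrite Cdiv_INR_sqr.
  change (Rabs (Im (li2_partial z n) + Im (RtoC (/ (INR (S n) * INR (S n))) * z ^ S n))
    <= Rabs (Im z) * (log_partial (Cmod z) n + Cmod z ^ n / INR (S n)))%R.
  apply Rle_trans with (1 := Rabs_triang _ _); rewrite im_scal_l, Rabs_mult.
  assert (Hi : (0 < / (INR (S n) * INR (S n)))%R)
    by (apply Rinv_0_lt_compat, Rmult_lt_0_compat; assumption).
  rewrite (Rabs_pos_eq (/ _)) by lra.
  assert (H := Rmult_le_compat_l _ _ _ (Rlt_le _ _ Hi) (Im_Cpow_le z n)).
  replace (/ (INR (S n) * INR (S n)) * (INR (S n) * Cmod z ^ n * Rabs (Im z)))%R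
    with (Rabs (Im z) * (Cmod z ^ n / INR (S n)))%R in H by (field; lra).
  lra.
Qed.

Lemma dilog_Im_le (L : C -> C) (hL : is_dilog L) (z : C) (N : nat) :
  (Cmod z <= 1)%R ->
  (Rabs (Im (L z)) <= Rabs (Im z) * log_partial (Cmod z) N
     + Cmod z ^ S N / (INR N + / 2))%R.
Proof.
intros Hz; assert (H1 := dilog_tail L hL z N Hz).
assert (H2 := Im_li2_partial_le z N).
assert (H3 := im_le_Cmod (L z - li2_partial z N)).
assert (H4 := Rabs_triang (Im (li2_partial z N)) (Im (L z - li2_partial z N))).
replace (Im (li2_partial z N) + Im (L z - li2_partial z N))%R with (Im (L z)) in H4
  by (unfold Re, Im; simpl; ring).
lra.
Qed.

Lemma Im_dilog_1 (L : C -> C) (hL : is_dilog L) : Im (L 1) = 0%R.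
Proof.
assert (H1 : (Cmod 1 <= 1)%R) by (rewrite Cmod_1; lra).
assert (H : forall N : nat, (Rabs (Im (L 1)) <= / (INR N + / 2))%R).
{ intros N; assert (H := dilog_tail L hL 1 N H1); rewrite Cmod_1, pow1 in H.
  assert (H3 := im_le_Cmod (L 1 - li2_partial 1 N)).
  replace (Im (L 1 - li2_partial 1 N)) with (Im (L 1)) in H3
    by (change (Im (L 1) = Im (L 1) - Im (li2_partial 1 N))%R;
        rewrite Im_li2_partial_1; ring).
  unfold Rdiv in H; lra. }
destruct (Req_dec (Im (L 1)) 0) as [H0|H0]; trivial; exfalso.
apply Rabs_pos_lt in H0.
destruct (archimed_cor1 _ H0) as [N [HN HN0]]; specialize (H N).
assert (HNp : (0 < INR N)%R) by now apply lt_0_INR.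
assert (/ (INR N + / 2) <= / INR N)%R by (apply Rinv_le_contravar; lra); lra.
Qed.

(** A rational bracket for zeta(2), taken in place of the value [PI^2 / 6]; its width is below 0.002
    already for [N = 8]. *)
Lemma Re_dilog_1_bounds (L : C -> C) (hL : is_dilog L) (N : nat) :
  (Re (li2_partial 1 N) + / (INR N + 5 / 8) <= Re (L 1)
   <= Re (li2_partial 1 N) + / (INR N + / 2))%R.
Proof.
assert (H1 : (Cmod 1 <= 1)%R) by (rewrite Cmod_1; lra).
split.
- apply Rnot_lt_le; intros Hlt.
  set (d := (Re (li2_partial 1 N) + / (INR N + 5 / 8) - Re (L 1))%R).
  assert (Hd : (0 < d / 4)%R) by (unfold d; lra).
  destruct (archimed_cor1 _ Hd) as [M [HM HM0]].
  assert (HMp : (0 < INR M)%R) by now apply lt_0_INR.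
  assert (H := dilog_tail L hL 1 (N + M) H1); rewrite Cmod_1, pow1 in H.
  assert (H2 := li2_partial_1_lower N M).
  assert (H3 := re_le_Cmod (L 1 - li2_partial 1 (N + M))).
  change (Re (L 1 - li2_partial 1 (N + M))) with
    (Re (L 1) - Re (li2_partial 1 (N + M)))%R in H3.
  assert (HNp := pos_INR N); rewrite plus_INR in *.
  assert (/ (INR N + INR M + / 2) <= / INR M)%R by (apply Rinv_le_contravar; lra).
  assert (/ (INR N + INR M + 5 / 8) <= / INR M)%R by (apply Rinv_le_contravar; lra).
  assert (H6 := Rle_abs (- (Re (L 1) - Re (li2_partial 1 (N + M))))%R).
  rewrite Rabs_Ropp in H6.
  unfold d in *; lra.
- assert (H := dilog_tail L hL 1 N H1); rewrite Cmod_1, pow1 in H.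
  assert (H3 := re_le_Cmod (L 1 - li2_partial 1 N)).
  change (Re (L 1 - li2_partial 1 N)) with (Re (L 1) - Re (li2_partial 1 N))%R in H3.
  assert (H4 := Rle_abs (Re (L 1) - Re (li2_partial 1 N))%R).
  unfold Rdiv in H; lra.
Qed.

Lemma Cpow_minus_1_le (z : C) (n : nat) :
  (Cmod z <= 1)%R -> (Cmod (z ^ n - 1) <= INR n * Cmod (z - 1))%R.
Proof.
intros Hz; induction n as [|n IH].
- replace (z ^ 0 - 1) with (RtoC 0) by (simpl; ring); rewrite Cmod_0; simpl; lra.
- rewrite Cpow_S, S_INR.
  replace (z * z ^ n - 1) with (z * (z ^ n - 1) + (z - 1)) by ring.
  apply Rle_trans with (1 := Cmod_triangle _ _); rewrite Cmod_mult.
  generalize (Cmod_ge_0 (z ^ n - 1)) (Cmod_ge_0 z); nra.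
Qed.

Lemma li2_partial_minus_1_le (z : C) (n : nat) : (Cmod z <= 1)%R ->
  (Cmod (li2_partial z n - li2_partial 1 n) <= INR n * Cmod (z - 1))%R.
Proof.
intros Hz; induction n as [|n IH]; cbn [li2_partial].
- replace (0 - 0) with (RtoC 0) by ring; rewrite Cmod_0; simpl; lra.
- rewrite Cpow_1_l.
  replace (INR (S n) * Cmod (z - 1))%R with (INR n * Cmod (z - 1) + Cmod (z - 1))%R
    by (rewrite S_INR; ring).
  assert (Hn := INR_S_neq_0 n).
  replace (li2_partial z n + z ^ S n / RtoC (INR (S n)) ^ 2
     - (li2_partial 1 n + 1 / RtoC (INR (S n)) ^ 2)) with
   ((li2_partial z n - li2_partial 1 n) + (z ^ S n - 1) / RtoC (INR (S n)) ^ 2)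
   by (field; exact Hn).
  apply Rle_trans with (1 := Cmod_triangle _ _).
  rewrite Cmod_div, Cmod_pow, Cmod_R by (now apply Cpow_nz).
  rewrite Rabs_pos_eq by apply pos_INR.
  assert (H := Cpow_minus_1_le z (S n) Hz).
  assert (H1 : (1 <= INR (S n))%R) by (rewrite S_INR; generalize (pos_INR n); lra).
  assert (H2 := Cmod_ge_0 (z - 1)).
  assert (Cmod (z ^ S n - 1) / INR (S n) ^ 2 <= Cmod (z - 1))%R; [ | lra ].
  apply Rmult_le_reg_r with (INR (S n) ^ 2)%R; [ nra | ].
  unfold Rdiv; rewrite Rmult_assoc, Rinv_l, Rmult_1_r by nra.
  apply Rle_trans with (1 := H).
  assert (0 <= (INR (S n) - 1) * Cmod (z - 1))%R by (apply Rmult_le_pos; lra).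
  nra.
Qed.

(** Quantitative continuity at the branch point 1, where holomorphy says nothing. The two tails cost
    [1 / N] each; [N] is to be balanced against the distance to 1. *)
Lemma dilog_near_1 (L : C -> C) (hL : is_dilog L) (z : C) (N : nat) :
  (Cmod z <= 1)%R -> (0 < N)%nat ->
  (Cmod (L z - L 1) <= INR N * Cmod (z - 1) + 2 / INR N)%R.
Proof.
intros Hz HN; assert (HNp : (0 < INR N)%R) by now apply lt_0_INR.
assert (H1 := li2_partial_minus_1_le z N Hz).
assert (H2 := dilog_tail L hL z N Hz).
assert (H3 : (Cmod 1 <= 1)%R) by (rewrite Cmod_1; lra).
assert (H4 := dilog_tail L hL 1 N H3); rewrite Cmod_1, pow1 in H4.
assert (H5 := pow_le_1 (Cmod z) (S N) (conj (Cmod_ge_0 z) Hz)).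
assert (H6 : (/ (INR N + / 2) <= / INR N)%R) by (apply Rinv_le_contravar; lra).
assert (H7 : (0 < / (INR N + / 2))%R) by (apply Rinv_0_lt_compat; lra).
replace (L z - L 1) with ((L z - li2_partial z N)
  + ((li2_partial z N - li2_partial 1 N) + - (L 1 - li2_partial 1 N))) by ring.
apply Rle_trans with (1 := Cmod_triangle _ _).
generalize (Cmod_triangle (li2_partial z N - li2_partial 1 N) (- (L 1 - li2_partial 1 N))).
rewrite Cmod_opp; unfold Rdiv in *; nra.
Qed.

(** * The derivative of the dilogarithm *)

(** A power series with complex coefficients at a real point; its components are real power series,
    which can be differentiated term by term. *)
Definition Cps (c : nat -> C) (s : R) : C :=
  (PSeries (fun n => Re (c n)) s, PSeries (fun n => Im (c n)) s).

Lemma Re_sum_n (a : nat -> C) (n : nat) : Re (sum_n a n) = sum_n (fun k => Re (a k)) n.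
Proof. induction n as [|n IH]; rewrite ?sum_O, ?sum_Sn; trivial; now rewrite <- IH. Qed.

Lemma Im_sum_n (a : nat -> C) (n : nat) : Im (sum_n a n) = sum_n (fun k => Im (a k)) n.
Proof. induction n as [|n IH]; rewrite ?sum_O, ?sum_Sn; trivial; now rewrite <- IH. Qed.

Lemma is_series_R_eps (a : nat -> R) (l : R) :
  (forall eps : R, (0 < eps)%R -> exists N : nat, forall n : nat, (N <= n)%nat ->
    (Rabs (l - sum_n a n) <= eps)%R) -> is_series a l.
Proof.
intros H; change (is_lim_seq (sum_n a) l); apply is_lim_seq_spec; intros eps.
destruct (H (eps / 2)%R ltac:(destruct eps; simpl; lra)) as [N HN].
exists N; intros n Hn; specialize (HN n Hn).
rewrite Rabs_minus_sym; destruct eps; simpl in *; lra.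
Qed.

Lemma Cps_eval (c : nat -> C) (s : R) (l : C) :
  (forall eps : R, (0 < eps)%R -> exists N : nat, forall n : nat, (N <= n)%nat ->
    (Cmod (l - sum_n (fun k => (c k * RtoC s ^ k)%C) n) <= eps)%R) -> Cps c s = l.
Proof.
intros H; apply C_eq; unfold Cps, PSeries; cbn [Re Im fst snd];
  apply is_series_unique, is_series_R_eps; intros eps Heps;
  destruct (H eps Heps) as [N HN]; exists N; intros n Hn;
  apply Rle_trans with (2 := HN n Hn).
- apply Rle_trans with (2 := re_le_Cmod _).
  change (Re (l - sum_n (fun k => (c k * RtoC s ^ k)%C) n)) with
    (Re l - Re (sum_n (fun k => (c k * RtoC s ^ k)%C) n))%R.
  rewrite Re_sum_n; right; do 2 f_equal; apply sum_n_ext; intros k.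
  now rewrite <- RtoC_pow, re_scal_r.
- apply Rle_trans with (2 := im_le_Cmod _).
  change (Im (l - sum_n (fun k => (c k * RtoC s ^ k)%C) n)) with
    (Im l - Im (sum_n (fun k => (c k * RtoC s ^ k)%C) n))%R.
  rewrite Im_sum_n; right; do 2 f_equal; apply sum_n_ext; intros k.
  now rewrite <- RtoC_pow, im_scal_r.
Qed.

Lemma CV_radius_geom (a : nat -> R) (rho : R) :
  (0 <= rho < 1)%R -> (forall n, (Rabs (a n) <= rho ^ n)%R) -> Rbar_lt 1 (CV_radius a).
Proof.
(* The reciprocal of the mean of 1 and [rho]: it exceeds 1, keeps [rho * r <= 1], and makes sense
   for [rho = 0]. *)
intros Hr Ha; set (r := (2 / (1 + rho))%R).
assert (Hr1 : (1 < r)%R).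
{ unfold r; apply Rmult_lt_reg_r with (1 + rho)%R; [ lra | ].
  unfold Rdiv; rewrite Rmult_assoc, Rinv_l; lra. }
assert (Hr2 : (0 <= rho * r <= 1)%R).
{ split; [ nra | unfold r ].
  apply Rmult_le_reg_r with (1 + rho)%R; [ lra | ].
  unfold Rdiv; rewrite !Rmult_assoc, Rinv_l; lra. }
apply Rbar_lt_le_trans with (Finite r); [ exact Hr1 | ].
apply (proj1 (CV_radius_bounded a)); exists 1%R; intros n.
rewrite Rabs_mult, <- RPow_abs, (Rabs_pos_eq r) by lra.
apply Rle_trans with (rho ^ n * r ^ n)%R.
- apply Rmult_le_compat_r; [ apply pow_le; lra | apply Ha ].
- rewrite <- Rpow_mult_distr; now apply pow_le_1.
Qed.

(** Geometric decay puts the radius of convergence strictly above 1, so the derivative at the end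
    point [s = 1] is two-sided. *)
Lemma dpath_Cps (c : nat -> C) (rho s : R) :
  (0 <= rho < 1)%R -> (forall n, (Cmod (c n) <= rho ^ n)%R) -> (0 <= s <= 1)%R ->
  dpath (Cps c) s (Cps (fun n => RtoC (INR (S n)) * c (S n)) s).
Proof.
intros Hr Hc Hs; split.
- replace (Re (Cps (fun n => RtoC (INR (S n)) * c (S n)) s)) with
    (PSeries (PS_derive (fun n => Re (c n))) s)
    by (apply PSeries_ext; intros n; unfold PS_derive; now rewrite re_scal_l).
  apply is_derive_PSeries.
  apply Rbar_le_lt_trans with (Finite 1%R); [ simpl; rewrite Rabs_pos_eq; lra | ].
  apply CV_radius_geom with rho; trivial.
  intros n; apply Rle_trans with (2 := Hc n), re_le_Cmod.
- replace (Im (Cps (fun n => RtoC (INR (S n)) * c (S n)) s)) with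
    (PSeries (PS_derive (fun n => Im (c n))) s)
    by (apply PSeries_ext; intros n; unfold PS_derive; now rewrite im_scal_l).
  apply is_derive_PSeries.
  apply Rbar_le_lt_trans with (Finite 1%R); [ simpl; rewrite Rabs_pos_eq; lra | ].
  apply CV_radius_geom with rho; trivial.
  intros n; apply Rle_trans with (2 := Hc n), im_le_Cmod.
Qed.

Lemma Cps_0 (c : nat -> C) : Cps c 0 = c O.
Proof. apply C_eq; unfold Cps; cbn [Re Im fst snd]; apply PSeries_0. Qed.

Lemma Cps_decr (c : nat -> C) (rho : R) :
  (0 <= rho < 1)%R -> (forall n, (Cmod (c n) <= rho ^ n)%R) ->
  Cps c 1 = c O + Cps (fun n => c (S n)) 1.
Proof.
intros Hr Hc.
assert (Hrad : forall f : C -> R, (forall z, (Rabs (f z) <= Cmod z)%R) ->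
  ex_pseries (fun n => f (c n)) 1).
{ intros f Hf; apply CV_disk_correct, CV_disk_inside; rewrite Rabs_R1.
  apply CV_radius_geom with rho; trivial.
  intros n; apply Rle_trans with (2 := Hc n), Hf. }
apply C_eq; unfold Cps; cbn [Re Im fst snd Cplus];
  rewrite PSeries_decr_1 by
    (apply (Hrad Re), re_le_Cmod || apply (Hrad Im), im_le_Cmod);
  now rewrite Rmult_1_l.
Qed.

Lemma pow_eps (rho K eps : R) : (0 <= rho < 1 -> 0 < eps ->
  exists N : nat, forall n, (N <= n)%nat -> K * rho ^ n <= eps)%R.
Proof.
intros Hr He.
assert (HK : (0 < Rabs K + 1)%R) by (generalize (Rabs_pos K); lra).
destruct (pow_lt_1_zero rho (ltac:(rewrite Rabs_pos_eq; lra)) (eps / (Rabs K + 1))%R)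
  as [N HN]; [ now apply Rdiv_lt_0_compat | ].
exists N; intros n Hn; specialize (HN n Hn).
assert (Hp := pow_le rho n (proj1 Hr)); rewrite Rabs_pos_eq in HN by assumption.
apply Rle_trans with ((Rabs K + 1) * rho ^ n)%R.
- apply Rmult_le_compat_r; trivial; generalize (Rle_abs K); lra.
- apply Rmult_le_reg_r with (/ (Rabs K + 1))%R; [ now apply Rinv_0_lt_compat | ].
  replace ((Rabs K + 1) * rho ^ n * / (Rabs K + 1))%R with (rho ^ n)%R by (field; lra).
  unfold Rdiv in HN; lra.
Qed.

(** The geometric series for the derivative of [- log (1 - s z)] in [s], from the closed form of its
    partial sums. *)
Lemma Cps_geom (z : C) (s : R) : (Cmod z < 1)%R -> (0 <= s <= 1)%R ->
  Cps (fun n => z ^ S n) s = z / (1 - s * z).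
Proof.
intros Hz Hs; assert (Hz0 := Cmod_ge_0 z).
assert (Hsz : (Cmod (s * z) <= Cmod z)%R)
  by (rewrite Cmod_mult, Cmod_R, Rabs_pos_eq by lra; nra).
assert (Hm : (1 - Cmod z <= Cmod (1 - s * z))%R)
  by (generalize (Cmod_minus_le 1 (s * z)); rewrite Cmod_1; lra).
assert (Hn : 1 - s * z <> 0) by (apply Cmod_gt_0; lra).
assert (Hsum : forall n, sum_n (fun k => (z ^ S k * RtoC s ^ k)%C) n
   = z / (1 - s * z) - z * (s * z) ^ S n / (1 - s * z)).
{ induction n as [|n IH].
  - rewrite sum_O.
    change (z ^ 1 * RtoC s ^ 0
      = z / (1 - s * z) - z * (s * z) ^ 1 / (1 - s * z)).
    cbn [Cpow]; field; exact Hn.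
  - rewrite sum_Sn, IH.
    change (z / (1 - s * z) - z * (s * z) ^ S n / (1 - s * z)
      + z ^ S (S n) * RtoC s ^ S n
      = z / (1 - s * z) - z * (s * z) ^ S (S n) / (1 - s * z)).
    rewrite (Cpow_S (s * z) (S n)), Cpow_mult_l, (Cpow_S z (S n)); field; exact Hn. }
apply Cps_eval; intros eps Heps.
destruct (pow_eps (Cmod z) (/ (1 - Cmod z)) eps) as [N HN]; [ lra | assumption | ].
exists N; intros n Hle; specialize (HN n Hle).
rewrite Hsum.
replace (z / (1 - s * z) - (z / (1 - s * z) - z * (s * z) ^ S n / (1 - s * z)))
  with (z * (s * z) ^ S n / (1 - s * z)) by ring.
rewrite Cmod_div, Cmod_mult, Cmod_pow by assumption.
apply Rle_trans with (2 := HN).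
assert (Hp := pow_le (Cmod z) n Hz0).
assert (H1 : (Cmod (s * z) ^ S n <= Cmod z ^ S n)%R)
  by (apply pow_incr; split; [ apply Cmod_ge_0 | assumption ]).
assert (H2 : (0 <= Cmod (s * z) ^ S n)%R) by apply pow_le, Cmod_ge_0.
assert (H3 : (Cmod z * Cmod (s * z) ^ S n <= Cmod z ^ n)%R).
{ cbn [pow] in *.
  apply Rle_trans with (1 * (Cmod z * Cmod z ^ n))%R; [ apply Rmult_le_compat; lra | nra ]. }
rewrite (Rmult_comm (/ _)); apply Rmult_le_compat.
- now apply Rmult_le_pos.
- left; apply Rinv_0_lt_compat; lra.
- assumption.
- apply Rinv_le_contravar; lra.
Qed.

Lemma Clog_1 : Clog 1 = 0.
Proof.
rewrite Clog_atan by (simpl; lra); rewrite Cmod_1, ln_1; simpl.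
now rewrite Rdiv_0_l, atan_0.
Qed.

Lemma Re_one_minus_pos (z : C) : (Cmod z < 1)%R -> (0 < Re (1 - z))%R.
Proof.
intros H; change (Re (1 - z)) with (1 + - Re z)%R.
generalize (re_le_Cmod z) (Rle_abs (Re z)); lra.
Qed.

Lemma C_const_of_dpath (g : R -> C) :
  (forall s, (0 <= s <= 1)%R -> dpath g s 0) -> g 1%R = g 0%R.
Proof.
intros H; assert (H1 := dpath_mvt g (fun _ => 0) 0 H
  (fun _ _ => Req_le _ _ Cmod_0)).
assert (H2 : g 1%R - g 0%R = 0)
  by (apply Cmod_eq_0; generalize (Cmod_ge_0 (g 1%R - g 0%R)); lra).
replace (g 1%R) with ((g 1%R - g 0%R) + g 0%R) by ring; rewrite H2; ring.
Qed.

Lemma Cmod_div_INR_le (z : C) (n : nat) :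
  (Cmod (z ^ S n / RtoC (INR (S n))) <= Cmod z ^ S n)%R.
Proof.
rewrite Cmod_div, Cmod_pow, Cmod_R by apply INR_S_neq_0.
assert (H1 : (1 <= INR (S n))%R) by (rewrite S_INR; generalize (pos_INR n); lra).
rewrite Rabs_pos_eq by lra.
assert (Hp := pow_le (Cmod z) (S n) (Cmod_ge_0 z)).
apply Rmult_le_reg_r with (INR (S n)); [ lra | ].
unfold Rdiv; rewrite Rmult_assoc, Rinv_l; nra.
Qed.

(** Coefficients in [s] of [- log (1 - s z)], and below of the dilogarithm of [s z]; the zero at
    index 0 aligns the powers of [s] and [z]. *)
Definition log_coef (z : C) (n : nat) : C :=
  match n with O => 0 | S m => z ^ n / RtoC (INR n) end.

Definition li2_coef (z : C) (n : nat) : C :=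
  match n with O => 0 | S m => z ^ n / RtoC (INR n) ^ 2 end.

Lemma log_coef_le (z : C) (n : nat) : (Cmod (log_coef z n) <= Cmod z ^ n)%R.
Proof.
destruct n as [|n]; [ simpl; rewrite Cmod_0; lra | apply Cmod_div_INR_le ].
Qed.

Lemma li2_coef_le (z : C) (n : nat) : (Cmod (li2_coef z n) <= Cmod z ^ n)%R.
Proof.
destruct n as [|n]; [ simpl; rewrite Cmod_0; lra | ].
unfold li2_coef; rewrite Cmod_li2_term.
assert (H1 : (1 <= INR (S n))%R) by (rewrite S_INR; generalize (pos_INR n); lra).
assert (Hp := pow_le (Cmod z) (S n) (Cmod_ge_0 z)).
apply Rmult_le_reg_r with (INR (S n) * INR (S n))%R; [ nra | ].
unfold Rdiv; rewrite Rmult_assoc, Rinv_l by nra.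
assert (1 <= INR (S n) * INR (S n))%R by nra; nra.
Qed.

Lemma Cps_ext (a b : nat -> C) (s : R) : (forall n, a n = b n) -> Cps a s = Cps b s.
Proof.
intros H; unfold Cps; f_equal; apply PSeries_ext; intros n; now rewrite H.
Qed.

(** Along [s z] with [0 <= s <= 1], the series and [- log (1 - s z)] have the same derivative and
    the same value at [s = 0]. *)
Lemma log_series (z : C) : (Cmod z < 1)%R ->
  Cps (fun n => z ^ S n / RtoC (INR (S n))) 1 = - Clog (1 - z).
Proof.
intros Hz; assert (Hz0 := Cmod_ge_0 z).
assert (Hd : forall s, (0 <= s <= 1)%R ->
  dpath (fun t => Cps (log_coef z) t + Clog (1 + t * (- z))) s 0).
{ intros s Hs.
  assert (Hsz : (Cmod (s * z) < 1)%R)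
    by (rewrite Cmod_mult, Cmod_R, Rabs_pos_eq by lra; nra).
  assert (Hre := Re_one_minus_pos _ Hsz).
  replace (1 - s * z) with (1 + s * - z) in Hre by ring.
  replace (RtoC 0) with (z / (1 - s * z) + - z / (1 + s * - z)).
  - apply dpath_plus.
    + rewrite <- (Cps_geom z s Hz Hs).
      rewrite <- (Cps_ext (fun n => RtoC (INR (S n)) * log_coef z (S n))).
      * apply dpath_Cps with (Cmod z); [ lra | apply log_coef_le | assumption ].
      * intros n; unfold log_coef; field; apply INR_S_neq_0.
    + apply (dpath_Clog (fun t => 1 + t * - z)); [ exact Hre | apply dpath_line ].
  - replace (1 + s * - z) with (1 - s * z) in * by ring.
    field; intros H0; rewrite H0 in Hre; simpl in Hre; lra. }
assert (H := C_const_of_dpath _ Hd); cbv beta in H.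
rewrite Cps_0, (Cps_decr _ (Cmod z)) in H; [ | lra | apply log_coef_le ].
replace (1 + 1%R * - z) with (1 - z) in H by ring.
replace (1 + 0%R * - z) with (RtoC 1) in H by ring.
rewrite Clog_1 in H; unfold log_coef in H.
set (A := Cps _ _) in *.
replace A with ((0 + A + Clog (1 - z)) - Clog (1 - z)) by ring.
rewrite H; ring.
Qed.

Lemma dilog_eq_Cps (L : C -> C) (hL : is_dilog L) (z : C) (s : R) :
  (Cmod (s * z) <= 1)%R -> L (s * z) = Cps (li2_coef z) s.
Proof.
intros H; symmetry; apply Cps_eval; intros eps Heps.
destruct (is_series_C_eps _ _ (proj2 hL _ H) eps Heps) as [N HN].
(* The zero coefficient shifts the index of the partial sums by one. *)
exists (S N); intros n Hn; destruct n as [|n]; [ lia | ].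
specialize (HN n ltac:(lia)).
replace (sum_n (fun k : nat => li2_coef z k * RtoC s ^ k) (S n)) with
  (sum_n (fun k : nat => (s * z) ^ S k / RtoC (INR (S k)) ^ 2) n); trivial.
clear; induction n as [|n IH].
- rewrite sum_Sn, !sum_O; unfold li2_coef.
  change ((s * z) ^ 1 / RtoC (INR 1) ^ 2
    = 0 * RtoC s ^ 0 + z ^ 1 / RtoC (INR 1) ^ 2 * RtoC s ^ 1).
  rewrite !Cpow_1_r; field; apply INR_S_neq_0.
- rewrite sum_Sn, IH, (sum_Sn _ (S n)); f_equal; unfold li2_coef.
  rewrite Cpow_mult_l; field; apply INR_S_neq_0.
Qed.

Lemma dpath_ext_loc (f g : R -> C) (s : R) (l : C) :
  locally s (fun t => f t = g t) -> dpath f s l -> dpath g s l.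
Proof.
intros H [H1 H2]; split; (eapply is_derive_ext_loc; [ | eassumption ]);
  apply filter_imp with (2 := H); intros t Ht; now rewrite Ht.
Qed.

Lemma dpath_unique (g : R -> C) (s : R) (a b : C) : dpath g s a -> dpath g s b -> a = b.
Proof.
intros [H1 H2] [H3 H4]; apply C_eq.
- rewrite <- (is_derive_unique _ _ _ H1); now apply is_derive_unique.
- rewrite <- (is_derive_unique _ _ _ H2); now apply is_derive_unique.
Qed.

Lemma dilog_domain_disk (z : C) : (Cmod z < 1)%R -> dilog_domain z.
Proof.
intros H [_ H1]; generalize (re_le_Cmod z) (Rle_abs (Re z)); lra.
Qed.

(* The complex derivative exists by hypothesis, so its value can be read off from
   the radial derivative, which is a derivative of real power series. *)
Lemma is_derive_dilog (L : C -> C) (hL : is_dilog L) (z : C) :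
  z <> 0 -> (Cmod z < 1)%R ->
  @is_derive C_AbsRing C_NormedModule L z (- Clog (1 - z) / z).
Proof.
intros Hz0 Hz.
destruct (proj1 hL z (dilog_domain_disk z Hz)) as [l Hl].
replace (- Clog (1 - z) / z) with l; trivial.
assert (Hc := Cmod_ge_0 z).
assert (H1 : dpath (fun t : R => L (0 + t * z)) 1 (l * z)).
{ apply (dpath_comp L (fun t => 0 + t * z)); [ | apply dpath_line ].
  replace (0 + 1%R * z) with z by ring; exact Hl. }
assert (H2 : dpath (fun t : R => L (0 + t * z)) 1 (- Clog (1 - z))).
{ apply dpath_ext_loc with (Cps (li2_coef z)).
  (* For [t < 2 - |z|] one has [t |z| <= 1 - (1 - |z|)^2 <= 1], so the series represents [L (t z)]
     on both sides of [t = 1]. *)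
  - assert (Hd : (0 < 1 - Cmod z)%R) by lra.
    exists (mkposreal _ Hd); intros t Ht.
    unfold ball in Ht; simpl in Ht; unfold AbsRing_ball, abs, minus, plus, opp in Ht;
      simpl in Ht; apply Rabs_def2 in Ht.
    replace (0 + t * z) with (t * z) by ring; symmetry; apply dilog_eq_Cps; trivial.
    rewrite Cmod_mult, Cmod_R, Rabs_pos_eq by lra; nra.
  - rewrite <- (log_series z Hz).
    rewrite <- (Cps_ext (fun n => RtoC (INR (S n)) * li2_coef z (S n))).
    + apply dpath_Cps with (Cmod z); [ lra | apply li2_coef_le | lra ].
    + intros n; unfold li2_coef; field; apply INR_S_neq_0. }
rewrite <- (dpath_unique _ _ _ _ H1 H2).
clear - Hz0; revert l; change (forall l : C, l = l * z / z).
intros l; field; exact Hz0.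
Qed.

Lemma dpath_dilog (L : C -> C) (hL : is_dilog L) (g : R -> C) (s : R) (l : C) :
  g s <> 0 -> (Cmod (g s) < 1)%R -> dpath g s l ->
  dpath (fun t => L (g t)) s (- Clog (1 - g s) / g s * l).
Proof. intros H0 H1 Hg; apply dpath_comp; trivial; now apply is_derive_dilog. Qed.

(** * Euler's reflection formula *)

(** Mean value inequality along [1 - s z], which keeps distance at least 1/2 from the origin. *)
Lemma Clog_one_minus_le (z : C) :
  (Cmod z <= / 2)%R -> (Cmod (Clog (1 - z)) <= 2 * Cmod z)%R.
Proof.
intros Hz; assert (Hz0 := Cmod_ge_0 z).
assert (Hs : forall s, (0 <= s <= 1)%R -> (Cmod (s * z) <= Cmod z)%R)
  by (intros s Hs; rewrite Cmod_mult, Cmod_R, Rabs_pos_eq by lra; nra).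
assert (H := dpath_mvt (fun t => Clog (1 + t * - z)) (fun s => - z / (1 + s * - z))
  (2 * Cmod z)).
replace (Clog (1 - z)) with (Clog (1 + 1%R * - z) - Clog (1 + 0%R * - z)).
- apply H; intros s Hs1; specialize (Hs s Hs1).
  + apply (dpath_Clog (fun t => 1 + t * - z)); [ | apply dpath_line ].
    replace (1 + s * - z) with (1 - s * z) by ring; apply Re_one_minus_pos; lra.
  + replace (1 + s * - z) with (1 - s * z) by ring.
    assert (Hm := Cmod_minus_le 1 (s * z)); rewrite Cmod_1 in Hm.
    rewrite Cmod_div, Cmod_opp by (apply Cmod_gt_0; lra).
    apply Rmult_le_reg_r with (Cmod (1 - s * z)); [ lra | ].
    unfold Rdiv; rewrite Rmult_assoc, Rinv_l by lra; nra.
- replace (1 + 1%R * - z) with (1 - z) by ring.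
  replace (1 + 0%R * - z) with (RtoC 1) by ring; rewrite Clog_1; ring.
Qed.

Lemma Cmod_Clog_le (z : C) : z <> 0 -> (Cmod (Clog z) <= Rabs (ln (Cmod z)) + PI)%R.
Proof.
intros Hz; apply Rle_trans with (1 := Cmod_le_abs _); simpl.
assert (H := Carg_bounds z Hz).
assert (Rabs (Carg z) <= PI)%R by (apply Rabs_le; lra); lra.
Qed.

Lemma eq_of_Cmod_le (a b : C) (K : R) :
  (forall m : nat, (2 <= m)%nat -> (Cmod (a - b) <= K / INR m)%R) -> a = b.
Proof.
intros H; assert (H0 : a - b = 0).
{ apply Cmod_eq_0; destruct (Req_dec (Cmod (a - b)) 0) as [He|He]; trivial; exfalso.
  assert (Hp : (0 < Cmod (a - b))%R) by (generalize (Cmod_ge_0 (a - b)); lra).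
  assert (HK : (0 < Rabs K + 1)%R) by (generalize (Rabs_pos K); lra).
  destruct (archimed_cor1 (Cmod (a - b) / (Rabs K + 1))%R) as [m [Hm Hm0]];
    [ now apply Rdiv_lt_0_compat | ].
  assert (Hmp : (0 < INR m)%R) by now apply lt_0_INR.
  specialize (H (m + 1)%nat ltac:(lia)); rewrite plus_INR in H; simpl (INR 1) in H.
  assert (H1 : (K / (INR m + 1) <= (Rabs K + 1) * / INR m)%R).
  { apply Rle_trans with ((Rabs K + 1) * / (INR m + 1))%R.
    - apply Rmult_le_compat_r; [ left; apply Rinv_0_lt_compat; lra | ].
      generalize (Rle_abs K); lra.
    - apply Rmult_le_compat_l; [ lra | apply Rinv_le_contravar; lra ]. }
  assert (H2 : ((Rabs K + 1) * / INR m < (Rabs K + 1) * (Cmod (a - b) / (Rabs K + 1)))%R)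
    by (apply Rmult_lt_compat_l; assumption).
  replace ((Rabs K + 1) * (Cmod (a - b) / (Rabs K + 1)))%R with (Cmod (a - b)) in H2
    by (field; lra).
  lra. }
replace a with ((a - b) + b) by ring; rewrite H0; ring.
Qed.


Definition refl_fun (L : C -> C) (z : C) : C :=
  L z + L (1 - z) + Clog z * Clog (1 - z).

(** The derivatives of the two dilogarithms cancel those of the product of logarithms. The segment
    from [w] towards 1 stays in both unit disks, around 0 and around 1; [k > 0] stops it short of
    1. *)
Lemma refl_fun_segment (L : C -> C) (hL : is_dilog L) (w : C) (k : R) :
  (Cmod w < 1)%R -> (Cmod (1 - w) < 1)%R -> (0 < k <= 1)%R ->
  refl_fun L w = refl_fun L (1 - k * (1 - w)).
Proof.
intros Hw Hu Hk; set (u := 1 - w) in *.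
set (b := RtoC (1 - k) * u).
assert (Hu0 : (0 < Cmod u)%R).
{ generalize (Cmod_minus_le 1 w); rewrite Cmod_1; unfold u; lra. }
assert (Ha := C_const_of_dpath
  (fun t => L (w + t * b) + L (u + t * - b) + Clog (w + t * b) * Clog (u + t * - b))).
cbv beta in Ha.
replace (w + 1%R * b) with (1 - k * u) in Ha by (unfold b, u; rewrite RtoC_minus; ring).
replace (u + 1%R * - b) with (k * u) in Ha by (unfold b, u; rewrite RtoC_minus; ring).
replace (w + 0%R * b) with w in Ha by ring.
replace (u + 0%R * - b) with u in Ha by ring.
unfold refl_fun; fold u; replace (1 - (1 - k * u)) with (k * u) by ring.
symmetry; apply Ha; clear Ha; intros s Hs.
(* The factor by which the distance to 1 has shrunk at time [s]: the running point is
   [1 - tau * u]. *)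
set (tau := (1 + s * (k - 1))%R).
assert (Ht : (0 < tau <= 1)%R) by (unfold tau; nra).
assert (E1 : u + s * - b = tau * u)
  by (unfold b, tau; rewrite RtoC_plus, RtoC_mult, !RtoC_minus; ring).
assert (E2 : 1 - (w + s * b) = tau * u) by (rewrite <- E1; unfold u; ring).
assert (E3 : w + s * b = 1 - (u + s * - b)) by (unfold u; ring).
assert (Hm1 : (0 < Cmod (tau * u) < 1)%R)
  by (rewrite Cmod_mult, Cmod_R, Rabs_pos_eq by lra; nra).
assert (Hm2 : (Cmod (w + s * b) < 1)%R).
{ replace (w + s * b) with (RtoC (1 - tau) + tau * w)
    by (rewrite E3, E1; unfold u; rewrite RtoC_minus; ring).
  apply Rle_lt_trans with (1 := Cmod_triangle _ _).
  rewrite Cmod_mult, !Cmod_R, !Rabs_pos_eq by lra; nra. }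
assert (Hn1 : u + s * - b <> 0) by (rewrite E1; apply Cmod_gt_0; lra).
assert (Hn2 : w + s * b <> 0).
{ apply Cmod_gt_0; rewrite E3, E1.
  generalize (Cmod_minus_le 1 (tau * u)); rewrite Cmod_1; lra. }
assert (Hre1 : (0 < Re (w + s * b))%R).
{ rewrite E3, E1; apply Re_one_minus_pos; lra. }
assert (Hre2 : (0 < Re (u + s * - b))%R).
{ rewrite E1, <- E2; apply Re_one_minus_pos; lra. }
assert (E4 : 1 - (u + s * - b) = w + s * b) by (unfold u; ring).
assert (E5 : 1 - (w + s * b) = u + s * - b) by (unfold u; ring).
assert (D1 := dpath_dilog L hL (fun t => w + t * b) s b Hn2 Hm2 (dpath_line _ _ _)).
assert (D2 := dpath_dilog L hL (fun t => u + t * - b) s (- b) Hn1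
   (eq_ind_r (fun z => (Cmod z < 1)%R) (proj2 Hm1) E1) (dpath_line _ _ _)).
assert (D3 := dpath_Clog (fun t => w + t * b) s b Hre1 (dpath_line _ _ _)).
assert (D4 := dpath_Clog (fun t => u + t * - b) s (- b) Hre2 (dpath_line _ _ _)).
cbv beta in D1, D2, D3, D4; rewrite E5 in D1; rewrite E4 in D2.
assert (D := dpath_plus _ _ _ _ _ (dpath_plus _ _ _ _ _ D1 D2) (dpath_mult _ _ _ _ _ D3 D4)).
cbv beta in D; match type of D with dpath _ _ ?d => replace d with (RtoC 0) in D end.
- exact D.
- set (Z := w + s * b) in *; set (Y := u + s * - b) in *.
  field; split; assumption.
Qed.

(* Moving [w] to [1] along a segment, on which the left side is constant. *)
Lemma dilog_reflection (L : C -> C) (hL : is_dilog L) (w : C) :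
  (Cmod w < 1)%R -> (Cmod (1 - w) < 1)%R ->
  L w + L (1 - w) + Clog w * Clog (1 - w) = L 1.
Proof.
intros Hw Hu; set (u := 1 - w) in *.
assert (Hu0 : (0 < Cmod u)%R).
{ generalize (Cmod_minus_le 1 w); rewrite Cmod_1; unfold u; lra. }
assert (HlnU : (ln (Cmod u) < 0)%R) by (rewrite <- ln_1; apply ln_increasing; lra).
apply eq_of_Cmod_le with (9 + 2 * (PI - ln (Cmod u)))%R; intros m Hm.
assert (Hm2 : (2 <= INR m)%R) by (apply (le_INR 2); assumption).
(* The balance is [m] terms at distance about [1 / m^2] from 1, so that [m k] and [1 / m] agree; the
   logarithm of [k] grows only like [2 ln m <= 2 m]. The three error terms contribute 3, 2 and
   [4 + 2 (PI - ln |u|)] to the constant. *)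
set (k := (/ (INR m * INR m))%R).
assert (Hk0 : (0 < k)%R) by (apply Rinv_0_lt_compat; nra).
assert (Hkm : (INR m * k = / INR m)%R) by (unfold k; field; lra).
assert (Hmi : (0 < / INR m <= / 2)%R).
{ split; [ apply Rinv_0_lt_compat | apply Rinv_le_contravar ]; lra. }
assert (Hk1 : (k <= / 2 * / INR m)%R).
{ replace k with (/ INR m * / INR m)%R by (unfold k; field; lra).
  apply Rmult_le_compat_r; lra. }
assert (HR := refl_fun_segment L hL w k Hw Hu ltac:(nra)); unfold refl_fun in HR.
fold u in HR; rewrite HR.
replace (1 - (1 - k * u)) with (k * u) by ring.
assert (Hku : Cmod (k * u) = (k * Cmod u)%R)
  by (rewrite Cmod_mult, Cmod_R, Rabs_pos_eq; lra).
assert (Hku1 : (k * Cmod u <= k)%R) by nra.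
assert (H1 : (Cmod (L (1 - k * u)%C - L 1%C) <= 3 / INR m)%R).
{ assert (Hz : (Cmod (1 - k * u) <= 1)%R).
  { replace (1 - k * u) with (RtoC (1 - k) + k * w)
      by (unfold u; rewrite RtoC_minus; ring).
    apply Rle_trans with (1 := Cmod_triangle _ _).
    rewrite Cmod_mult, !Cmod_R, !Rabs_pos_eq by nra; nra. }
  apply Rle_trans with (1 := dilog_near_1 L hL _ m Hz ltac:(lia)).
  replace (1 - k * u - 1) with (- (k * u)) by ring.
  rewrite Cmod_opp, Hku; unfold Rdiv; nra. }
assert (Hku2 : (Cmod (k * u) <= / 2)%R) by (rewrite Hku; nra).
assert (Hku3 : k * u <> 0) by (apply Cmod_gt_0; rewrite Hku; nra).
assert (H2 : (Cmod (L (k * u)%C) <= 2 / INR m)%R).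
{ apply Rle_trans with (1 := dilog_norm_le L hL (k * u) ltac:(lra)).
  rewrite Hku; unfold Rdiv; nra. }
assert (H3 : (Cmod (Clog (1 - k * u)) <= 2 * k)%R).
{ apply Rle_trans with (1 := Clog_one_minus_le (k * u) Hku2).
  rewrite Hku; lra. }
assert (H4 : (Cmod (Clog (k * u)) <= 2 * INR m + (PI - ln (Cmod u)))%R).
{ apply Rle_trans with (1 := Cmod_Clog_le (k * u) Hku3).
  rewrite Hku, ln_mult by lra.
  assert (Hlk : ln k = (- (2 * ln (INR m)))%R).
  { unfold k; rewrite ln_Rinv, ln_mult by nra; ring. }
  assert (0 < ln (INR m))%R by (rewrite <- ln_1; apply ln_increasing; lra).
  assert (ln (INR m) < INR m)%R.
  { apply exp_lt_inv; rewrite exp_ln by lra; generalize (exp_ineq1 (INR m)); lra. }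
  rewrite Rabs_left by lra; lra. }
assert (H5 : (Cmod (Clog (1 - k * u) * Clog (k * u))
   <= (4 + 2 * (PI - ln (Cmod u))) / INR m)%R).
{ rewrite Cmod_mult.
  apply Rle_trans with (2 * k * (2 * INR m + (PI - ln (Cmod u))))%R.
  - apply Rmult_le_compat; trivial; apply Cmod_ge_0.
  - replace (2 * k * (2 * INR m + (PI - ln (Cmod u))))%R with
      (4 * (INR m * k) + 2 * k * (PI - ln (Cmod u)))%R by ring.
    rewrite Hkm; generalize PI_RGT_0; intros; unfold Rdiv; nra. }
replace (L (1 - k * u) + L (k * u) + Clog (1 - k * u) * Clog (k * u) - L 1) with
  ((L (1 - k * u) - L 1) + (L (k * u) + Clog (1 - k * u) * Clog (k * u))) by ring.
apply Rle_trans with (1 := Cmod_triangle _ _).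
generalize (Cmod_triangle (L (k * u)) (Clog (1 - k * u) * Clog (k * u))).
unfold Rdiv in *; lra.
Qed.

(** * Banach's fixed point theorem on a disk *)

(** Completeness is applied to the real and imaginary parts separately; adding their bounds produces
    the factor 2. *)
Lemma C_cauchy_geom (x : nat -> C) (k r : R) : (0 <= k < 1)%R -> (0 <= r)%R ->
  (forall n p, (Cmod (x (n + p)%nat - x n) <= k ^ n * r)%R) ->
  exists l : C, forall n, (Cmod (l - x n) <= k ^ n * (2 * r))%R.
Proof.
intros Hk Hr Hx.
assert (Hcv : forall f : C -> R, (forall a b, (Rabs (f a - f b) <= Cmod (a - b))%R) ->
  exists l : R, forall n, (Rabs (l - f (x n)) <= k ^ n * r)%R).
{ intros f Hf.
  assert (Hc : ex_lim_seq_cauchy (fun n => f (x n))).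
  { intros eps; destruct (pow_eps k (2 * r) (eps / 2)%R Hk) as [N HN];
      [ destruct eps; simpl; lra | ].
    specialize (HN N (Nat.le_refl N)).
    assert (HxN : forall n, (N <= n)%nat -> (Rabs (f (x n) - f (x N)) <= k ^ N * r)%R).
    { intros n Hn; apply Rle_trans with (1 := Hf _ _).
      replace n with (N + (n - N))%nat by lia; apply Hx. }
    exists N; intros n m Hn Hm.
    assert (H1 := HxN n Hn); assert (H2 := HxN m Hm).
    rewrite Rabs_minus_sym in H2.
    assert (H3 := Rabs_triang (f (x n) - f (x N)) (f (x N) - f (x m))).
    replace (f (x n) - f (x N) + (f (x N) - f (x m)))%R with (f (x n) - f (x m))%R
      in H3 by ring.
    destruct eps; simpl in *; lra. }
  apply ex_lim_seq_cauchy_corr in Hc; destruct Hc as [l Hl].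
  exists l; intros n.
  assert (Hl2 : is_lim_seq (fun p => f (x (p + n)%nat)) l)
    by (now apply (is_lim_seq_incr_n (fun n => f (x n)))).
  assert (Hl3 : is_lim_seq (fun p => Rabs (f (x (p + n)%nat) - f (x n)))
     (Rabs (l - f (x n)))).
  { apply (is_lim_seq_abs _ (Finite (l - f (x n))%R)).
    apply is_lim_seq_minus'; [ exact Hl2 | apply is_lim_seq_const ]. }
  apply (is_lim_seq_le _ _ _ _ (fun p => Rle_trans _ _ _ (Hf (x (p + n)%nat) (x n))
    (eq_ind_r (fun q => (Cmod (x q - x n) <= k ^ n * r)%R) (Hx n p) (Nat.add_comm p n)))
    Hl3 (is_lim_seq_const _)). }
destruct (Hcv Re) as [a Ha].
{ intros y z; apply Rle_trans with (2 := re_le_Cmod _); right; reflexivity. }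
destruct (Hcv Im) as [b Hb].
{ intros y z; apply Rle_trans with (2 := im_le_Cmod _); right; reflexivity. }
exists (a, b); intros n; apply Rle_trans with (1 := Cmod_le_abs _).
specialize (Ha n); specialize (Hb n).
change (Re ((a, b) - x n)) with (a - Re (x n))%R.
change (Im ((a, b) - x n)) with (b - Im (x n))%R; lra.
Qed.

(** The condition on [F c] makes the disk stable. Then every iterate is within [r] of the start, and
    contracting [n] times gives the Cauchy estimate without summing increments. *)
Lemma banach_disk (F : C -> C) (c : C) (k r : R) :
  (0 <= k < 1)%R -> (0 <= r)%R ->
  (forall a b, (Cmod (a - c) <= r)%R -> (Cmod (b - c) <= r)%R ->
     (Cmod (F a - F b) <= k * Cmod (a - b))%R) ->
  (Cmod (F c - c) <= (1 - k) * r)%R ->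
  exists x, (Cmod (x - c) <= r)%R /\ F x = x.
Proof.
intros Hk Hr HF Hc.
assert (Hcc : (Cmod (c - c) <= r)%R)
  by (replace (c - c) with (RtoC 0) by ring; rewrite Cmod_0; assumption).
assert (Hstab : forall a, (Cmod (a - c) <= r)%R -> (Cmod (F a - c) <= r)%R).
{ intros a Ha; assert (H1 := HF a c Ha Hcc).
  replace (F a - c) with ((F a - F c) + (F c - c)) by ring.
  apply Rle_trans with (1 := Cmod_triangle _ _); nra. }
set (x := fun n => Nat.iter n F c).
assert (Hin : forall n, (Cmod (x n - c) <= r)%R)
  by (induction n as [|n IH]; [ exact Hcc | now apply Hstab ]).
assert (Hx : forall n p, (Cmod (x (n + p)%nat - x n) <= k ^ n * r)%R).
{ induction n as [|n IH]; intros p.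
  - simpl (k ^ 0)%R; rewrite Rmult_1_l; apply Hin.
  - apply Rle_trans with (1 := HF (x (n + p)%nat) (x n) (Hin _) (Hin _)).
    simpl; specialize (IH p); nra. }
destruct (C_cauchy_geom x k r Hk Hr Hx) as [l Hl].
assert (Hlc : (Cmod (l - c) <= r)%R).
{ apply Rnot_lt_le; intros Hlt.
  destruct (pow_eps k (2 * r) ((Cmod (l - c) - r) / 2)%R Hk ltac:(lra)) as [N HN].
  specialize (HN N (Nat.le_refl N)); specialize (Hl N); specialize (Hin N).
  assert (H := Cmod_triangle (l - x N) (x N - c)).
  replace (l - x N + (x N - c)) with (l - c) in H by ring; lra. }
exists l; split; trivial.
assert (H0 : F l - l = 0).
{ apply Cmod_eq_0; apply Rle_antisym; [ | apply Cmod_ge_0 ].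
  apply Rnot_lt_le; intros Hlt.
  (* [|F l - l| <= |F l - F x_N| + |x_(N+1) - l|], and each summand is at most [2 r k^N]. *)
  destruct (pow_eps k (4 * r) (Cmod (F l - l) / 2)%R Hk ltac:(lra)) as [N HN].
  specialize (HN N (Nat.le_refl N)).
  assert (H1 := Hl N); assert (H2 := Hl (S N)).
  assert (H3 := HF l (x N) Hlc (Hin N)).
  assert (H := Cmod_triangle (F l - x (S N)) (- (l - x (S N)))).
  rewrite Cmod_opp in H.
  replace (F l - x (S N) + - (l - x (S N))) with (F l - l) in H by ring.
  change (x (S N)) with (F (x N)) in H at 1; cbn [pow] in H2.
  assert (Hp := pow_le k N (proj1 Hk)); assert (Hm := Cmod_ge_0 (l - x N)).
  assert (k * k ^ N * (2 * r) <= k ^ N * (2 * r))%R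
    by (apply Rmult_le_compat_r; [ lra | nra ]).
  assert (k * Cmod (l - x N) <= Cmod (l - x N))%R by nra.
  lra. }
replace (F l) with ((F l - l) + l) by ring; rewrite H0; ring.
Qed.

(** * Elementary numerical bounds *)

(** Each elementary inequality below is a difference that vanishes at 0 and has a nonnegative
    derivative. *)
Lemma nonneg_of_derive (f df : R -> R) (x : R) :
  (0 <= x -> f 0 = 0 -> (forall t, 0 <= t <= x -> is_derive f t (df t)) ->
  (forall t, 0 <= t <= x -> 0 <= df t) -> 0 <= f x)%R.
Proof.
intros Hx H0 Hd Hp.
destruct (MVT_gen f 0 x df) as [c [Hc Heq]].
- rewrite Rmin_left, Rmax_right by lra; intros; apply Hd; lra.
- rewrite Rmin_left, Rmax_right by lra; intros t Ht.
  apply continuity_pt_filterlim, @ex_derive_continuous; eexists; apply Hd; lra.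
- rewrite Rmin_left, Rmax_right in Hc by lra; specialize (Hp c Hc); nra.
Qed.

Open Scope R_scope.

(** The derivative of the difference is the remainder of the geometric series of [1 / (1 + t^2)];
    likewise for the upper bound. *)
Lemma atan_lower (x : R) : 0 <= x -> x - x ^ 3 / 3 + x ^ 5 / 5 - x ^ 7 / 7 <= atan x.
Proof.
intros Hx.
assert (0 <= atan x - (x - x ^ 3 / 3 + x ^ 5 / 5 - x ^ 7 / 7)); [ | lra ].
apply (nonneg_of_derive (fun t => atan t - (t - t ^ 3 / 3 + t ^ 5 / 5 - t ^ 7 / 7))
  (fun t => t ^ 8 / (1 + t * t))); trivial.
- rewrite atan_0; field.
- intros t Ht; auto_derive; trivial; unfold Rsqr; field; nra.
- intros t Ht; apply Rdiv_le_0_compat; [ apply pow_le; lra | nra ].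
Qed.

Lemma atan_upper (x : R) :
  0 <= x -> atan x <= x - x ^ 3 / 3 + x ^ 5 / 5 - x ^ 7 / 7 + x ^ 9 / 9.
Proof.
intros Hx.
assert (0 <= x - x ^ 3 / 3 + x ^ 5 / 5 - x ^ 7 / 7 + x ^ 9 / 9 - atan x); [ | lra ].
apply (nonneg_of_derive
  (fun t => t - t ^ 3 / 3 + t ^ 5 / 5 - t ^ 7 / 7 + t ^ 9 / 9 - atan t)
  (fun t => t ^ 10 / (1 + t * t))); trivial.
- rewrite atan_0; field.
- intros t Ht; auto_derive; trivial; unfold Rsqr; field; nra.
- intros t Ht; apply Rdiv_le_0_compat; [ apply pow_le; lra | nra ].
Qed.

(** From [PI / 4 = 2 atan (1/3) + atan (1/7)]. *)
Lemma PI_bounds : 3.141 < PI < 3.142.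
Proof.
assert (H := Machin_2_3_7).
assert (H1 := atan_lower (/ 3) ltac:(lra)); assert (H2 := atan_upper (/ 3) ltac:(lra)).
assert (H3 := atan_lower (/ 7) ltac:(lra)); assert (H4 := atan_upper (/ 7) ltac:(lra)).
lra.
Qed.

Lemma cos_lower (x : R) : 0 <= x -> 1 - x ^ 2 / 2 <= cos x.
Proof.
intros Hx; assert (0 <= cos x - (1 - x ^ 2 / 2)); [ | lra ].
apply (nonneg_of_derive (fun t => cos t - (1 - t ^ 2 / 2)) (fun t => t - sin t)); trivial.
- rewrite cos_0; field.
- intros t Ht; auto_derive; trivial; field.
- intros t Ht; destruct (Req_dec t 0) as [->|]; [ rewrite sin_0; lra | ].
  generalize (sin_lt_x t ltac:(lra)); lra.
Qed.

Lemma sin_lower (x : R) : 0 <= x -> x - x ^ 3 / 6 <= sin x.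
Proof.
intros Hx; assert (0 <= sin x - (x - x ^ 3 / 6)); [ | lra ].
apply (nonneg_of_derive (fun t => sin t - (t - t ^ 3 / 6))
  (fun t => cos t - (1 - t ^ 2 / 2))); trivial.
- rewrite sin_0; field.
- intros t Ht; auto_derive; trivial; field.
- intros t Ht; generalize (cos_lower t ltac:(lra)); lra.
Qed.

Lemma exp_lower (x : R) : 0 <= x -> 1 + x + x ^ 2 / 2 <= exp x.
Proof.
intros Hx; assert (0 <= exp x - (1 + x + x ^ 2 / 2)); [ | lra ].
apply (nonneg_of_derive (fun t => exp t - (1 + t + t ^ 2 / 2))
  (fun t => exp t - (1 + t))); trivial.
- rewrite exp_0; field.
- intros t Ht; auto_derive; trivial; field.
- intros t Ht; generalize (exp_ineq1_le t); lra.
Qed.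

(** [exp x = exp (x / 8) ^ 8], and at [x / 8] the quadratic bound is sharp enough. *)
Lemma exp_lower_8 (x : R) : 0 <= x -> (1 + x / 8 + (x / 8) ^ 2 / 2) ^ 8 <= exp x.
Proof.
intros Hx; replace (exp x) with (exp (x / 8) ^ 8).
- apply pow_incr; split; [ nra | apply exp_lower; lra ].
- rewrite <- (Rpower_pow 8 (exp (x / 8)) (exp_pos _)); unfold Rpower.
  rewrite ln_exp; f_equal; simpl; field.
Qed.

(** The last term majorises the tail [x^3 / 3 + x^4 / 4 + ...] by a geometric series. *)
Lemma ln_one_minus_lower (x : R) : 0 <= x < 1 ->
  - x - x ^ 2 / 2 - x ^ 3 / 3 / (1 - x) <= ln (1 - x).
Proof.
intros Hx; assert (0 <= ln (1 - x) - (- x - x ^ 2 / 2 - x ^ 3 / 3 / (1 - x))); [ | lra ].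
apply (nonneg_of_derive (fun t => ln (1 - t) - (- t - t ^ 2 / 2 - t ^ 3 / 3 / (1 - t)))
  (fun t => t ^ 3 / 3 / (1 - t) ^ 2)); try lra.
- rewrite Rminus_0_r, ln_1; field.
- intros t Ht; auto_derive; [ repeat split; lra | field; lra ].
- intros t Ht; apply Rdiv_le_0_compat; [ | apply pow_lt; lra ].
  assert (0 <= t ^ 3) by (apply pow_le; lra); lra.
Qed.

Lemma ln_one_minus_upper (x : R) : 0 <= x < 1 -> ln (1 - x) <= - x - x ^ 2 / 2.
Proof.
intros Hx; assert (0 <= - x - x ^ 2 / 2 - ln (1 - x)); [ | lra ].
apply (nonneg_of_derive (fun t => - t - t ^ 2 / 2 - ln (1 - t))
  (fun t => t ^ 2 / (1 - t))); try lra.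
- rewrite Rminus_0_r, ln_1; field.
- intros t Ht; auto_derive; [ repeat split; lra | field; lra ].
- intros t Ht; apply Rdiv_le_0_compat; [ nra | lra ].
Qed.

(** [1/2 = (9/10)^6 * (500000 / 531441)], with both bases close to 1. *)
Lemma ln_2_bounds : 0.6909 <= ln 2 <= 0.6935.
Proof.
assert (E : ln 2 = - (6 * ln (1 - / 10) + ln (1 - (1 - 500000 / 531441)))).
{ assert (H : ln (/ 2) = ln ((1 - / 10) ^ 6 * (1 - (1 - 500000 / 531441))))
    by (f_equal; field).
  rewrite ln_Rinv, ln_mult, ln_pow in H by (try apply pow_lt; lra); simpl INR in H; lra. }
assert (H1 := ln_one_minus_lower (/ 10) ltac:(lra)).
assert (H2 := ln_one_minus_upper (/ 10) ltac:(lra)).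
assert (H3 := ln_one_minus_lower (1 - 500000 / 531441) ltac:(lra)).
assert (H4 := ln_one_minus_upper (1 - 500000 / 531441) ltac:(lra)).
rewrite E; split; lra.
Qed.

(** * Locating the zero *)

Open Scope C_scope.

(* Numerical approximations of [1 - w] and [log w]. *)
Definition u0 : C := (0.0315, 0.1095)%R.
Definition l0 : C := Clog (1 - u0).

Lemma Clog_parts (x y : R) : (0 < x)%R ->
  Clog (x, y) = (/ 2 * ln (x * x + y * y), atan (y / x))%R.
Proof.
intros Hx; apply C_eq.
- rewrite Re_Clog_sqr; [ reflexivity | ].
  intros H; apply (f_equal Re) in H; simpl in H; lra.
- now rewrite Clog_atan.
Qed.

Lemma l0_bounds :
  (-0.02566 <= Re l0 <= -0.02563 /\ -0.11259 <= Im l0 <= -0.11257)%R.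
Proof.
unfold l0, u0; replace (1 - (0.0315, 0.1095)%R) with (0.9685, - 0.1095)%R
  by (apply C_eq; simpl; lra).
rewrite Clog_parts by lra; simpl Re; simpl Im.
replace (0.9685 * 0.9685 + - 0.1095 * - 0.1095)%R with (1 - 0.0500175)%R by lra.
replace (- 0.1095 / 0.9685)%R with (- (219 / 1937))%R by lra; rewrite atan_opp.
assert (H1 := ln_one_minus_lower 0.0500175 ltac:(lra)).
assert (H2 := ln_one_minus_upper 0.0500175 ltac:(lra)).
assert (H3 := atan_lower (219 / 1937) ltac:(lra)).
assert (H4 := atan_upper (219 / 1937) ltac:(lra)).
lra.
Qed.

Lemma Clog_u0_bounds :
  (-2.174 <= Re (Clog u0) <= -2.164 /\ 1.289 <= Im (Clog u0) <= 1.292)%R.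
Proof.
unfold u0; rewrite Clog_parts by lra; simpl Re; simpl Im.
(* [|u0|^2 = 0.83088 / 2^6]: the power of 2 brings the argument of [ln] close to 1. *)
assert (E : ln (0.0315 * 0.0315 + 0.1095 * 0.1095)
   = (ln (1 - 0.16912) - 6 * ln 2)%R).
{ replace (6 * ln 2)%R with (ln (2 ^ 6)) by (rewrite ln_pow by lra; simpl; ring).
  rewrite <- ln_div by lra; f_equal; lra. }
rewrite E.
(* The slope is too large for the Taylor bounds; its inverse is not. *)
replace (0.1095 / 0.0315)%R with (73 / 21)%R by lra.
replace (73 / 21)%R with (/ (21 / 73))%R by field; rewrite atan_inv by lra.
assert (H1 := ln_one_minus_lower 0.16912 ltac:(lra)).
assert (H2 := ln_one_minus_upper 0.16912 ltac:(lra)).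
assert (H3 := atan_lower (21 / 73) ltac:(lra)).
assert (H4 := atan_upper (21 / 73) ltac:(lra)).
assert (H5 := ln_2_bounds); assert (H6 := PI_bounds); lra.
Qed.

Lemma Re_dilog_1_num (L : C -> C) (hL : is_dilog L) : (1.6433 <= Re (L 1) <= 1.6451)%R.
Proof.
assert (H := Re_dilog_1_bounds L hL 8).
assert (E : Re (li2_partial 1 8) =
  (1 + / 4 + / 9 + / 16 + / 25 + / 36 + / 49 + / 64)%R).
{ unfold li2_partial; rewrite !Cpow_1_l, !Cdiv_INR_sqr; unfold Re; simpl; field. }
rewrite E in H; replace (INR 8) with 8%R in H by (simpl; ring).
replace (/ (8 + 5 / 8))%R with (8 / 69)%R in H by field.
replace (/ (8 + / 2))%R with (2 / 17)%R in H by field; lra.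
Qed.

Lemma dilog_u0_num (L : C -> C) (hL : is_dilog L) :
  (0.0280 <= Re (L u0) <= 0.0295 /\ 0.1105 <= Im (L u0) <= 0.1120)%R.
Proof.
assert (Hm : (Cmod u0 <= 0.115)%R)
  by (apply Cmod_le_of_sqr; unfold u0; simpl; lra).
assert (H := dilog_tail L hL u0 2 ltac:(lra)).
assert (Hp : (Cmod u0 ^ 3 <= 0.115 ^ 3)%R)
  by (apply pow_incr; split; [ apply Cmod_ge_0 | assumption ]).
replace (Cmod u0 ^ 3 / (INR 2 + / 2))%R with (2 / 5 * Cmod u0 ^ 3)%R in H
  by (simpl; field).
assert (H1 := re_le_Cmod (L u0 - li2_partial u0 2)).
assert (H2 := im_le_Cmod (L u0 - li2_partial u0 2)).
assert (E1 : Re (li2_partial u0 2) = (0.0315 + (0.0315 * 0.0315 - 0.1095 * 0.1095) / 4)%R).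
{ unfold li2_partial, u0; rewrite !Cdiv_INR_sqr; unfold Re; simpl; field. }
assert (E2 : Im (li2_partial u0 2) = (0.1095 + (2 * 0.0315 * 0.1095) / 4)%R).
{ unfold li2_partial, u0; rewrite !Cdiv_INR_sqr; unfold Im; simpl; field. }
change (Re (L u0 - li2_partial u0 2)) with (Re (L u0) - Re (li2_partial u0 2))%R in H1.
change (Im (L u0 - li2_partial u0 2)) with (Im (L u0) - Im (li2_partial u0 2))%R in H2.
rewrite E1 in H1; rewrite E2 in H2.
assert (H3 : (Cmod (L u0 - li2_partial u0 2) <= 0.0007)%R) by lra.
apply Rle_trans with (2 := H3) in H1; apply Rle_trans with (2 := H3) in H2.
apply Rcomplements.Rabs_le_between in H1, H2; lra.
Qed.

Lemma mult_interval (x y a b c d : R) :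
  (0 <= a <= x -> x <= b -> 0 <= c <= y -> y <= d -> a * c <= x * y <= b * d)%R.
Proof. intros; split; apply Rmult_le_compat; lra. Qed.

Lemma four_pi_i_neq_0 : 4 * PI * Ci <> 0.
Proof.
apply Cmod_gt_0; rewrite !Cmod_mult, Cmod_Ci, !Cmod_R, !Rabs_pos_eq;
  generalize PI_bounds; lra.
Qed.

Lemma Cmod_four_pi_i : Cmod (4 * PI * Ci) = (4 * PI)%R.
Proof.
rewrite !Cmod_mult, Cmod_Ci, !Cmod_R, !Rabs_pos_eq; generalize PI_bounds; lra.
Qed.

(* A zero of [L w = 4 pi i log w] is [exp] of a fixed point of this map, whose
   derivative [- log (1 - exp l) / (4 pi i)] has modulus about [1/5]. *)
Definition zero_map (L : C -> C) (l : C) : C := L (Cexp l) / (4 * PI * Ci).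

Lemma Cmod_one_minus_u0 : (Cmod (1 - u0) < 1)%R /\ (Cmod u0 < 1)%R.
Proof.
split.
- apply Rle_lt_trans with 0.98%R; [ apply Cmod_le_of_sqr; unfold u0; simpl; lra | lra ].
- apply Rle_lt_trans with 0.2%R; [ apply Cmod_le_of_sqr; unfold u0; simpl; lra | lra ].
Qed.

(** Reflection replaces [L (1 - u0)] by [L 1 - L u0 - l0 log u0], all of whose parts are accessible.
    The bound is the hypothesis of the fixed point theorem for [k = 1/4], [r = 0.0005]. *)
Lemma zero_map_center (L : C -> C) (hL : is_dilog L) :
  (Cmod (zero_map L l0 - l0) <= (1 - / 4) * 0.0005)%R.
Proof.
destruct Cmod_one_minus_u0 as [Hm1 Hm2].
assert (Hn : 1 - u0 <> 0).
{ intros H; apply (f_equal Re) in H; unfold u0 in H; simpl in H; lra. }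
assert (HR := dilog_reflection L hL (1 - u0) Hm1
  ltac:(replace (1 - (1 - u0))%C with u0 by ring; assumption)).
replace (1 - (1 - u0)) with u0 in HR by ring; fold l0 in HR.
unfold zero_map; replace (Cexp l0) with (1 - u0) by (symmetry; now apply Cexp_Clog).
assert (H4 := four_pi_i_neq_0).
replace (L (1 - u0) / (4 * PI * Ci) - l0) with
  ((L 1 - L u0 - l0 * (Clog u0 + 4 * PI * Ci)) / (4 * PI * Ci)).
2: { rewrite <- HR; field; repeat split; intros H0; apply H4; rewrite H0; ring. }
rewrite Cmod_div, Cmod_four_pi_i by assumption.
assert (HPI := PI_bounds).
apply Rle_trans with (0.0035 / (4 * PI))%R.
- apply Rmult_le_compat_r; [ left; apply Rinv_0_lt_compat; lra | ].
  destruct l0_bounds as [Ha Hb], Clog_u0_bounds as [HA HB].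
  assert (H1 := Re_dilog_1_num L hL); assert (H1' := Im_dilog_1 L hL).
  destruct (dilog_u0_num L hL) as [Hr Hi].
  (* The imaginary part of [log u0 + 4 pi i]. Signs are arranged so that all factors are positive;
     with the products enclosed, the rest is linear. *)
  set (B := (Im (Clog u0) + 4 * PI)%R).
  assert (HB' : (13.853 <= B <= 13.860)%R) by (unfold B; lra).
  assert (P1 := mult_interval (- Re l0) (- Re (Clog u0)) 0.02563 0.02566 2.164 2.174
    ltac:(lra) ltac:(lra) ltac:(lra) ltac:(lra)).
  assert (P2 := mult_interval (- Im l0) B 0.11257 0.11259 13.853 13.860
    ltac:(lra) ltac:(lra) ltac:(lra) ltac:(lra)).
  assert (P3 := mult_interval (- Re l0) B 0.02563 0.02566 13.853 13.860
    ltac:(lra) ltac:(lra) ltac:(lra) ltac:(lra)).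
  assert (P4 := mult_interval (- Im l0) (- Re (Clog u0)) 0.11257 0.11259 2.164 2.174
    ltac:(lra) ltac:(lra) ltac:(lra) ltac:(lra)).
  set (D := L 1 - L u0 - l0 * (Clog u0 + 4 * PI * Ci)).
  assert (E1 : Re D = (Re (L 1) - Re (L u0)
     - (- Re l0 * - Re (Clog u0) + - Im l0 * B))%R).
  { unfold D, B, Re, Im; simpl; ring. }
  assert (E2 : Im D = (Im (L 1) - Im (L u0)
     - (- (- Re l0 * B) + - Im l0 * - Re (Clog u0)))%R).
  { unfold D, B, Re, Im; simpl; ring. }
  assert (HD1 : (-0.0026 <= Re D <= 0.0026)%R) by (rewrite E1; lra).
  assert (HD2 : (-0.0020 <= Im D <= 0.0020)%R) by (rewrite E2, H1'; lra).
  apply Cmod_le_of_sqr; [ lra | clear - HD1 HD2; nra ].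
- apply Rmult_le_reg_r with (4 * PI)%R; [ lra | ].
  unfold Rdiv; rewrite Rmult_assoc, Rinv_l; lra.
Qed.

(** The bound [-0.0251] on [Re l] is the value that the vertical segments have to exceed. *)
Lemma l0_disk_bounds (l : C) : (Cmod (l - l0) <= 0.0005)%R ->
  (-0.0262 <= Re l <= -0.0251 /\ -0.1132 <= Im l <= -0.112)%R.
Proof.
intros H; destruct l0_bounds as [Ha Hb].
assert (H1 := re_le_Cmod (l - l0)); assert (H2 := im_le_Cmod (l - l0)).
change (Re (l - l0)) with (Re l - Re l0)%R in H1.
change (Im (l - l0)) with (Im l - Im l0)%R in H2.
apply Rle_trans with (2 := H) in H1; apply Rle_trans with (2 := H) in H2.
apply Rcomplements.Rabs_le_between in H1, H2; lra.
Qed.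

Lemma Cexp_num (l : C) :
  (-0.0262 <= Re l <= -0.0251 -> -0.1132 <= Im l <= -0.112 ->
   0.108 <= - Im (Cexp l) <= 0.12 /\ 0.96 <= Re (Cexp l) < 1 /\
   0 < 1 - Re (Cexp l) <= 0.0333 /\ Cmod (Cexp l) < 1)%R.
Proof.
intros Ha Hb; rewrite Re_Cexp, Im_Cexp, Cmod_Cexp.
set (b := (- Im l)%R); replace (Im l) with (- b)%R by (unfold b; ring).
rewrite cos_neg, sin_neg.
assert (He1 := exp_ineq1_le (Re l)).
assert (He2 : (exp (Re l) < 1)%R) by (rewrite <- exp_0; apply exp_increasing; lra).
assert (Hb' : (0.112 <= b <= 0.1132)%R) by (unfold b; lra).
assert (Hc1 := cos_lower b ltac:(lra)); assert (Hs1 := sin_lower b ltac:(lra)).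
assert (Hs2 := sin_lt_x b ltac:(lra)); assert (Hc2 := COS_bound b).
assert (H2 : (b ^ 2 <= 0.1132 ^ 2)%R) by (apply pow_incr; lra).
assert (H3 : (b ^ 3 <= 0.1132 ^ 3)%R) by (apply pow_incr; lra).
assert (Hs3 : (0.1117 <= sin b <= 0.1132)%R) by lra.
assert (Hc3 : (0.9935 <= cos b <= 1)%R) by lra.
assert (He3 : (0.9738 <= exp (Re l))%R) by lra.
clear - He2 He3 Hs3 Hc3; nra.
Qed.

(** From [0.1 <= |1 - W| <= 2] the real part is at most 2.5 in modulus, the imaginary part is below
    [PI / 2], and [2.5^2 + (PI / 2)^2 <= PI^2]. Against the divisor [4 PI], the bound [PI] gives the
    contraction factor 1/4. *)
Lemma Cmod_Clog_le_PI (W : C) :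
  (0.1 <= - Im W -> Cmod W < 1 -> Cmod (Clog (1 - W)) <= PI)%R.
Proof.
intros Hi Hm; assert (HPI := PI_bounds).
assert (H1 : (10 <= exp 2.5)%R).
{ apply Rle_trans with (2 := exp_lower_8 2.5 ltac:(lra)); lra. }
assert (H2 : (0.1 <= Cmod (1 - W))%R).
{ apply Rle_trans with (2 := im_le_Cmod _).
  change (Im (1 - W)) with (0 + - Im W)%R; rewrite Rabs_pos_eq; lra. }
assert (H3 : (Cmod (1 - W) <= 2)%R).
{ replace (1 - W) with (1 + - W) by ring.
  apply Rle_trans with (1 := Cmod_triangle _ _); rewrite Cmod_1, Cmod_opp; lra. }
destruct (Clog_bounds (1 - W) 2.5) as [Hr Hj].
- now apply Re_one_minus_pos.
- lra.
- rewrite exp_Ropp; apply Rle_trans with (2 := H2).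
  apply Rle_trans with (/ 10)%R; [ apply Rinv_le_contravar; lra | lra ].
- apply Cmod_le_of_sqr; [ lra | ].
  apply Rcomplements.Rabs_le_between in Hr; apply Rabs_def2 in Hj; nra.
Qed.

Lemma zero_map_contraction (L : C -> C) (hL : is_dilog L) (a b : C) :
  (Cmod (a - l0) <= 0.0005)%R -> (Cmod (b - l0) <= 0.0005)%R ->
  (Cmod (zero_map L a - zero_map L b) <= / 4 * Cmod (a - b))%R.
Proof.
intros Ha Hb.
assert (Hin : forall s, (0 <= s <= 1)%R -> (Cmod (b + s * (a - b) - l0) <= 0.0005)%R).
{ intros s Hs.
  replace (b + s * (a - b) - l0) with (RtoC (1 - s) * (b - l0) + s * (a - l0))
    by (rewrite RtoC_minus; ring).
  apply Rle_trans with (1 := Cmod_triangle _ _).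
  rewrite !Cmod_mult, !Cmod_R, !Rabs_pos_eq by lra; nra. }
assert (H4 := four_pi_i_neq_0).
assert (H := dpath_mvt (fun t => / (4 * PI * Ci) * L (Cexp (b + t * (a - b))))
  (fun s => / (4 * PI * Ci) * (- Clog (1 - Cexp (b + s * (a - b))) / Cexp (b + s * (a - b))
      * ((a - b) * Cexp (b + s * (a - b))))) (/ 4 * Cmod (a - b))).
cbv beta in H.
replace (b + 1%R * (a - b)) with a in H by ring.
replace (b + 0%R * (a - b)) with b in H by ring.
unfold zero_map, Cdiv.
rewrite (Cmult_comm (L (Cexp a))), (Cmult_comm (L (Cexp b))).
apply H; clear H; intros s Hs; specialize (Hin s Hs);
  destruct (l0_disk_bounds _ Hin) as [Hr Hi];
  destruct (Cexp_num _ Hr Hi) as (Hn1 & Hn2 & Hn3 & Hn4).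
- apply dpath_scal, dpath_dilog; trivial; [ apply Cexp_neq_0 | ].
  apply (dpath_Cexp (fun t => b + t * (a - b))), dpath_line.
- set (W := Cexp (b + s * (a - b))) in *.
  assert (HW : W <> 0) by apply Cexp_neq_0.
  replace (- Clog (1 - W) / W * ((a - b) * W)) with (- Clog (1 - W) * (a - b))
    by (field; exact HW).
  rewrite !Cmod_mult, Cmod_inv, Cmod_four_pi_i, Cmod_opp by assumption.
  assert (HC := Cmod_Clog_le_PI W ltac:(lra) Hn4).
  assert (HPI := PI_bounds); assert (Hp := Cmod_ge_0 (a - b)).
  apply Rle_trans with (/ (4 * PI) * (PI * Cmod (a - b)))%R.
  + apply Rmult_le_compat_l; [ left; apply Rinv_0_lt_compat; lra | ].
    apply Rmult_le_compat_r; assumption.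
  + right; field; lra.
Qed.

(** Since [|Im l| < PI / 2], [Clog] inverts [Cexp] at [l], and the fixed point equation becomes the
    equation for the zero. *)
Lemma dilog_zero_exists (L : C -> C) (hL : is_dilog L) :
  exists l : C, dilog_zero L (Cexp l) /\
    (-0.0262 <= Re l <= -0.0251)%R /\ (-0.1132 <= Im l <= -0.112)%R.
Proof.
destruct (banach_disk (zero_map L) l0 (/ 4) 0.0005) as [l [Hl Hfix]]; try lra.
- intros a b; now apply zero_map_contraction.
- now apply zero_map_center.
- destruct (l0_disk_bounds l Hl) as [Hr Hi].
  exists l; repeat split; try lra; try apply Cexp_neq_0.
  + apply dilog_domain_disk; now apply (Cexp_num l).
  + rewrite Clog_Cexp by (generalize PI_bounds; lra).
    rewrite <- Hfix at 2; unfold zero_map.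
    assert (H4 := four_pi_i_neq_0).
    replace (4 * PI * Ci * (L (Cexp l) / (4 * PI * Ci))) with (L (Cexp l)).
    * ring.
    * field; repeat split; intros H0; apply H4; rewrite H0; ring.
Qed.

(** * The vertical segments *)

Lemma Cexp_2_pi_i (x y : R) :
  Cexp (2 * PI * Ci * (x, y)) =
  (exp (- (2 * PI * y)) * cos (2 * PI * x), exp (- (2 * PI * y)) * sin (2 * PI * x))%R.
Proof.
replace (2 * PI * Ci * (x, y)) with (- (2 * PI * y), 2 * PI * x)%R
  by (apply C_eq; simpl; ring).
apply C_eq; [ rewrite Re_Cexp | rewrite Im_Cexp ]; reflexivity.
Qed.

Lemma two_pi_i_neq_0 : 2 * PI * Ci <> 0.
Proof.
apply Cmod_gt_0; rewrite !Cmod_mult, Cmod_Ci, !Cmod_R, !Rabs_pos_eq;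
  generalize PI_bounds; lra.
Qed.

(** [L 1] is real, so [Re p] is a real quotient with positive denominator [2 PI |z|^2], which is
    cleared here. *)
Lemma lt_Re_p (L : C -> C) (hL : is_dilog L) (x y P : R) :
  let e := Cexp (2 * PI * Ci * (x, y)) in
  (0 < x)%R ->
  (x * Im (L e) + y * (Re (L 1) - Re (L e)) < 2 * PI * - P * (x * x + y * y))%R ->
  (P < Re (p L (x, y)))%R.
Proof.
intros e Hx H; unfold p; fold e.
assert (HPI := PI_bounds).
assert (Hq : (0 < x * x + y * y)%R) by nra.
assert (E : Re ((L 1 - L e) / (2 * PI * Ci * (x, y)))
  = (- (x * Im (L e) + y * (Re (L 1) - Re (L e))) / (2 * PI * (x * x + y * y)))%R).
{ replace (2 * PI * Ci * (x, y)) with (- (2 * PI * y), 2 * PI * x)%R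
    by (apply C_eq; simpl; ring).
  assert (HI := Im_dilog_1 L hL).
  unfold Cdiv; rewrite re_mult.
  change (Re (L 1 - L e)) with (Re (L 1) - Re (L e))%R.
  change (Im (L 1 - L e)) with (Im (L 1) - Im (L e))%R; rewrite HI.
  simpl; field; repeat split; try lra.
  replace (- (2 * PI * y) * - (2 * PI * y) + 2 * PI * x * (2 * PI * x))%R with
    (4 * (PI * PI) * (x * x + y * y))%R by ring.
  assert (0 < PI * PI)%R by nra; nra. }
rewrite E.
apply Rcomplements.Rlt_div_r; [ nra | lra ].
Qed.

Lemma log_partial_mono (r R0 : R) (n : nat) :
  (0 <= r <= R0 -> 0 <= log_partial r n <= log_partial R0 n)%R.
Proof.
intros H; induction n as [|n IH]; cbn [log_partial]; [ lra | ].
assert (Hn : (0 < / INR (S n))%R) by apply Rinv_0_lt_compat, lt_0_INR, Nat.lt_0_succ.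
assert (H1 : (r ^ n <= R0 ^ n)%R) by (apply pow_incr; lra).
assert (H2 : (0 <= r ^ n)%R) by (apply pow_le; lra).
unfold Rdiv; nra.
Qed.

(** [k] bounds the sine of the argument of [z] and [R0] its modulus, so the right side is purely
    numerical. *)
Lemma dilog_Im_num (L : C -> C) (hL : is_dilog L) (z : C) (k R0 : R) (N : nat) :
  (0 <= k -> Cmod z <= R0 -> R0 <= 1 -> Rabs (Im z) <= k * Cmod z ->
   Im (L z) <= k * (R0 * log_partial R0 N) + R0 ^ S N / (INR N + / 2))%R.
Proof.
intros Hk H1 H2 H3; assert (H0 := Cmod_ge_0 z).
apply Rle_trans with (1 := Rle_abs _).
apply Rle_trans with (1 := dilog_Im_le L hL z N ltac:(lra)).
assert (Hl := log_partial_mono (Cmod z) R0 N ltac:(lra)).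
apply Rplus_le_compat.
- rewrite <- Rmult_assoc; apply Rmult_le_compat; try lra; [ apply Rabs_pos | nra ].
- apply Rmult_le_compat_r; [ | now apply pow_incr ].
  left; apply Rinv_0_lt_compat; generalize (pos_INR N); lra.
Qed.

Lemma exp_neg_le (x y B : R) :
  (0 <= x <= y -> / (1 + x + x ^ 2 / 2) <= B -> exp (- y) <= B)%R.
Proof.
intros H HB; apply Rle_trans with (2 := HB).
apply Rle_trans with (exp (- x)).
- destruct (Req_dec x y) as [->|]; [ lra | left; apply exp_increasing; lra ].
- rewrite exp_Ropp; apply Rinv_le_contravar; [ nra | apply exp_lower; lra ].
Qed.

(** The tail after one term. On the left side [e] points almost along the positive axis, which makes
    [Re (L e)] nonnegative; on the right side it gives [-5/3 |e|]. *)
Lemma dilog_minus_id_le (L : C -> C) (hL : is_dilog L) (z : C) :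
  (Cmod z <= 1 -> Re z - 2 / 3 * Cmod z <= Re (L z))%R.
Proof.
intros Hz; assert (H := dilog_tail L hL z 1 Hz).
replace (Cmod z ^ 2 / (INR 1 + / 2))%R with (2 / 3 * (Cmod z * Cmod z))%R in H
  by (simpl; field).
assert (E : Re (L z - li2_partial z 1) = (Re (L z) - Re z)%R).
{ unfold li2_partial; rewrite Cdiv_INR_sqr, Cpow_1_r; unfold Re; simpl; field. }
assert (H1 := re_le_Cmod (L z - li2_partial z 1)); rewrite E in H1.
assert (H2 := Rle_abs (- (Re (L z) - Re z))%R); rewrite Rabs_Ropp in H2.
assert (H0 := Cmod_ge_0 z); nra.
Qed.

Lemma sin_small : (0 <= sin (0.02 * PI) <= 0.06284)%R /\ (0.99 <= cos (0.02 * PI) <= 1)%R.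
Proof.
assert (HPI := PI_bounds); split.
- split; [ apply sin_ge_0; lra | ].
  generalize (sin_lt_x (0.02 * PI) ltac:(lra)); lra.
- assert (H := cos_lower (0.02 * PI) ltac:(lra)); assert (H1 := COS_bound (0.02 * PI)).
  assert (H2 : ((0.02 * PI) ^ 2 <= 0.07 ^ 2)%R) by (apply pow_incr; lra); lra.
Qed.

Lemma trig_left : sin (2 * PI * 2.01) = sin (0.02 * PI) /\
  cos (2 * PI * 2.01) = cos (0.02 * PI).
Proof.
replace (2 * PI * 2.01)%R with (0.02 * PI + 2 * INR 2 * PI)%R by (simpl; lra).
now rewrite sin_period, cos_period.
Qed.

Lemma trig_right : sin (2 * PI * 2.49) = sin (0.02 * PI) /\
  cos (2 * PI * 2.49) = (- cos (0.02 * PI))%R.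
Proof.
replace (2 * PI * 2.49)%R with ((PI - 0.02 * PI) + 2 * INR 2 * PI)%R by (simpl; lra).
rewrite sin_period, cos_period, sin_PI_x, Rtrigo_facts.cos_pi_minus.
split; ring.
Qed.

Lemma Cexp_vertical (x y : R) :
  let e := Cexp (2 * PI * Ci * (x, y)) in
  Cmod e = exp (- (2 * PI * y)) /\ Re e = (Cmod e * cos (2 * PI * x))%R /\
  Im e = (Cmod e * sin (2 * PI * x))%R.
Proof.
intros e.
assert (Hm : Cmod e = exp (- (2 * PI * y))).
{ unfold e; rewrite Cmod_Cexp; f_equal; simpl; ring. }
split; trivial; unfold e at 1 3; rewrite Cexp_2_pi_i, Hm; now split.
Qed.

Ltac log_num := unfold log_partial; simpl INR; simpl pow; lra.

Lemma log_partial_1_num : (log_partial 1 16 <= 3.381)%R.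
Proof. unfold log_partial; rewrite !pow1; simpl INR; lra. Qed.

Lemma log_partial_85_num : (log_partial 0.85 8 <= 2.1)%R.
Proof. log_num. Qed.

Lemma log_partial_62_num : (log_partial 0.62 6 <= 1.55)%R.
Proof. log_num. Qed.

Lemma log_partial_33_num : (log_partial 0.33 4 <= 1.22)%R.
Proof. log_num. Qed.

Lemma left_segment (L : C -> C) (hL : is_dilog L) (y P : R) :
  (0 <= y <= 0.332 -> P <= -0.0251 -> P < Re (p L (2.01, y)))%R.
Proof.
intros Hy HP; assert (HPI := PI_bounds).
apply lt_Re_p; trivial; [ lra | ].
destruct (Cexp_vertical 2.01 y) as (Hm & Hr & Hi).
set (e := Cexp (2 * PI * Ci * (2.01%R, y))) in *.
destruct trig_left as [Hs Hc], sin_small as [Hs1 Hc1].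
rewrite Hs in Hi; rewrite Hc in Hr.
assert (H0 := Cmod_ge_0 e).
assert (H1 : (Cmod e <= 1)%R).
{ rewrite Hm, <- exp_0; destruct (Req_dec y 0) as [->|];
    [ right; f_equal; ring | left; apply exp_increasing; nra ]. }
assert (Hie : (Rabs (Im e) <= 0.06284 * Cmod e)%R)
  by (rewrite Hi, Rabs_pos_eq by nra; nra).
assert (HRe : (0 <= Re (L e))%R)
  by (generalize (dilog_minus_id_le L hL e H1); rewrite Hr; nra).
assert (HL1 := Re_dilog_1_num L hL).
assert (HZ : (y * (Re (L 1) - Re (L e)) <= y * 1.6451)%R)
  by (apply Rmult_le_compat_l; lra).
(* [6.282 * 0.0251 * 2.01^2], from [2 PI >= 6.282] and dropping [y^2]. *)
assert (HQ : (0.637 <= 2 * PI * - P * (2.01 * 2.01 + y * y))%R).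
{ assert (6.282 * 0.0251 <= 2 * PI * - P)%R by (apply Rmult_le_compat; lra).
  assert (0 <= y * y)%R by nra.
  apply Rle_trans with (6.282 * 0.0251 * (2.01 * 2.01))%R; [ lra | ].
  apply Rmult_le_compat; lra. }
apply Rlt_le_trans with (2 := HQ); clear HQ.
(* As [y] grows, the term [y L(1)] grows while [|e|] decays. On the three ranges [|e|] is at most 1,
   0.85 and 0.33. *)
destruct (Rle_dec y 0.03) as [Hy1|Hy1]; [ | destruct (Rle_dec y 0.2) as [Hy2|Hy2] ].
- assert (HI := dilog_Im_num L hL e 0.06284 1 16 ltac:(lra) H1 ltac:(lra) Hie).
  rewrite pow1 in HI; replace (INR 16) with 16%R in HI by (simpl; ring).
  replace (1 / (16 + / 2))%R with (2 / 33)%R in HI by field.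
  assert (HN := log_partial_1_num); lra.
- assert (HR : (Cmod e <= 0.85)%R).
  { rewrite Hm; apply exp_neg_le with 0.188%R; [ split; nra | ].
    apply Rle_trans with (/ 1.2)%R; [ apply Rinv_le_contravar; lra | lra ]. }
  assert (HI := dilog_Im_num L hL e 0.06284 0.85 8 ltac:(lra) HR ltac:(lra) Hie).
  replace (INR 8) with 8%R in HI by (simpl; ring).
  replace (0.85 ^ 9 / (8 + / 2))%R with (0.85 ^ 9 * (2 / 17))%R in HI by field.
  assert (HN := log_partial_85_num); lra.
- assert (HR : (Cmod e <= 0.33)%R).
  { rewrite Hm; apply exp_neg_le with 1.256%R; [ split; nra | ].
    apply Rle_trans with (/ 3.04)%R; [ apply Rinv_le_contravar; lra | lra ]. }
  assert (HI := dilog_Im_num L hL e 0.06284 0.33 4 ltac:(lra) HR ltac:(lra) Hie).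
  replace (INR 4) with 4%R in HI by (simpl; ring).
  replace (0.33 ^ 5 / (4 + / 2))%R with (0.33 ^ 5 * (2 / 9))%R in HI by field.
  assert (HN := log_partial_33_num); lra.
Qed.

(** The maximum is [1 / e], attained at [x = 1], and [e >= 2.5]. *)
Lemma mul_exp_neg_le (x : R) : (x * exp (- x) <= 0.4)%R.
Proof.
assert (H := exp_ineq1_le (x - 1)).
assert (H1 := exp_lower 1 ltac:(lra)).
assert (Hp := exp_pos (- x)).
assert (E : (exp (x - 1) * exp (- x) = / exp 1)%R).
{ rewrite <- exp_plus, <- exp_Ropp; f_equal; ring. }
apply Rle_trans with (/ exp 1)%R; [ rewrite <- E; nra | ].
apply Rle_trans with (/ 2.5)%R; [ apply Rinv_le_contravar; lra | lra ].
Qed.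

Lemma right_segment (L : C -> C) (hL : is_dilog L) (y P : R) :
  (0 <= y <= 0.411 -> P <= -0.0251 -> P < Re (p L (2.49, y)))%R.
Proof.
intros Hy HP; assert (HPI := PI_bounds).
apply lt_Re_p; trivial; [ lra | ].
destruct (Cexp_vertical 2.49 y) as (Hm & Hr & Hi).
set (e := Cexp (2 * PI * Ci * (2.49%R, y))) in *.
destruct trig_right as [Hs Hc], sin_small as [Hs1 Hc1].
rewrite Hs in Hi; rewrite Hc in Hr.
assert (H0 := Cmod_ge_0 e).
assert (H1 : (Cmod e <= 1)%R).
{ rewrite Hm, <- exp_0; destruct (Req_dec y 0) as [->|];
    [ right; f_equal; ring | left; apply exp_increasing; nra ]. }
assert (Hie : (Rabs (Im e) <= 0.06284 * Cmod e)%R)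
  by (rewrite Hi, Rabs_pos_eq by nra; nra).
assert (HRe : (- (5 / 3 * Cmod e) <= Re (L e))%R)
  by (generalize (dilog_minus_id_le L hL e H1); rewrite Hr; nra).
assert (HL1 := Re_dilog_1_num L hL).
assert (HZ : (y * (Re (L 1) - Re (L e)) <= y * 1.6451 + 5 / 3 * (y * Cmod e))%R).
{ replace (y * 1.6451 + 5 / 3 * (y * Cmod e))%R with (y * (1.6451 + 5 / 3 * Cmod e))%R
    by ring; apply Rmult_le_compat_l; lra. }
assert (HQ : (0.977 <= 2 * PI * - P * (2.49 * 2.49 + y * y))%R).
{ assert (6.282 * 0.0251 <= 2 * PI * - P)%R by (apply Rmult_le_compat; lra).
  assert (0 <= y * y)%R by nra.
  apply Rle_trans with (6.282 * 0.0251 * (2.49 * 2.49))%R; [ lra | ].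
  apply Rmult_le_compat; lra. }
apply Rlt_le_trans with (2 := HQ); clear HQ.
destruct (Rle_dec y 0.08) as [Hy1|Hy1].
- assert (HI := dilog_Im_num L hL e 0.06284 1 16 ltac:(lra) H1 ltac:(lra) Hie).
  rewrite pow1 in HI; replace (INR 16) with 16%R in HI by (simpl; ring).
  replace (1 / (16 + / 2))%R with (2 / 33)%R in HI by field.
  assert (y * Cmod e <= 0.08 * 1)%R by (apply Rmult_le_compat; lra).
  assert (HN := log_partial_1_num); lra.
- assert (HR : (Cmod e <= 0.62)%R).
  { rewrite Hm; apply exp_neg_le with 0.5%R; [ split; nra | ].
    apply Rle_trans with (/ 1.625)%R; [ apply Rinv_le_contravar; lra | lra ]. }
  assert (HI := dilog_Im_num L hL e 0.06284 0.62 6 ltac:(lra) HR ltac:(lra) Hie).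
  replace (INR 6) with 6%R in HI by (simpl; ring).
  replace (0.62 ^ 7 / (6 + / 2))%R with (0.62 ^ 7 * (2 / 13))%R in HI by field.
  (* [|e| = exp (- 2 PI y)], so [y |e| <= 0.4 / (2 PI)] uniformly in [y]. *)
  assert (HE := mul_exp_neg_le (2 * PI * y)); rewrite <- Hm in HE.
  assert (0 <= y * Cmod e)%R by nra.
  assert (y * Cmod e <= 0.0637)%R by nra.
  assert (HN := log_partial_62_num); lra.
Qed.

(** * The ray through the critical point *)

(** [|1 - exp (2 pi i t (1 + i v))|^2] written in real terms. *)
Definition ray_modulus (v t : R) : R :=
  (1 - 2 * exp (- (2 * PI * v * t)) * cos (2 * PI * t)
   + exp (- (2 * PI * v * t)) * exp (- (2 * PI * v * t)))%R.

Lemma trig_shift (t : R) :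
  cos (2 * PI * t) = cos (2 * PI * (t - 2)) /\ sin (2 * PI * t) = sin (2 * PI * (t - 2)).
Proof.
replace (2 * PI * t)%R with (2 * PI * (t - 2) + 2 * INR 2 * PI)%R by (simpl; ring).
now rewrite cos_period, sin_period.
Qed.

(** The sign of the derivative is that of [sin theta + v cos theta - v r], where
    [theta = 2 PI (t - 2)] lies in the first quadrant and [r < 1] is the modulus of the
    exponential. *)
Lemma ray_modulus_increasing (v s t : R) :
  (0 < v <= 1 -> 2 <= s < t -> t <= 2.25 -> ray_modulus v s < ray_modulus v t)%R.
Proof.
intros Hv Hst Ht; assert (HPI := PI_bounds).
set (r := fun t => exp (- (2 * PI * v * t))).
destruct (MVT_cor2 (ray_modulus v) (fun t => 4 * PI * r t *
  (sin (2 * PI * t) + v * cos (2 * PI * t) - v * r t))%R s t) as [c [Heq Hc]].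
- lra.
- intros c Hc; apply is_derive_Reals; unfold ray_modulus, r; auto_derive; trivial; ring.
- destruct (trig_shift c) as [E1 E2].
  assert (Hth : (0 < 2 * PI * (c - 2) < PI / 2)%R) by (split; nra).
  assert (Hcos : (0 < cos (2 * PI * (c - 2)))%R) by (apply cos_gt_0; lra).
  assert (Hsin : (0 < sin (2 * PI * (c - 2)))%R) by (apply sin_gt_0; lra).
  assert (H2 := sin2_cos2 (2 * PI * (c - 2))); unfold Rsqr in H2.
  assert (Hr : (0 < r c < 1)%R).
  { split; [ apply exp_pos | unfold r; rewrite <- exp_0; apply exp_increasing ].
    assert (0 < 2 * PI * v)%R by nra; nra. }
  rewrite E1, E2 in Heq.
  set (S1 := sin _) in *; set (C1 := cos _) in *.
  (* [sin + v cos >= v (sin + cos) >= v (sin^2 + cos^2) = v] *)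
  assert (Hd : (0 < S1 + v * C1 - v * r c)%R).
  { assert (C1 <= 1)%R by nra; assert (S1 <= 1)%R by nra.
    assert (S1 * S1 <= S1)%R by nra; assert (C1 * C1 <= C1)%R by nra.
    assert (1 <= S1 + C1)%R by lra.
    assert (v * 1 <= v * (S1 + C1))%R by (apply Rmult_le_compat_l; lra).
    nra. }
  assert (0 < 4 * PI * r c * (S1 + v * C1 - v * r c) * (t - s))%R; [ | lra ].
  apply Rmult_lt_0_compat; [ | lra ]; apply Rmult_lt_0_compat; trivial.
  apply Rmult_lt_0_compat; lra.
Qed.

(** Between a quarter and a half turn the cosine is at most 0. *)
Lemma ray_modulus_gt_1 (v t : R) : (2.25 <= t <= 2.5 -> 1 < ray_modulus v t)%R.
Proof.
intros Ht; assert (HPI := PI_bounds); unfold ray_modulus.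
assert (Hr := exp_pos (- (2 * PI * v * t))).
destruct (trig_shift t) as [E1 _]; rewrite E1.
assert (cos (2 * PI * (t - 2)) <= 0)%R by (apply cos_le_0; nra); nra.
Qed.

Lemma ray_modulus_eq (v t : R) :
  (Cmod (1 - Cexp (t * (2 * PI * Ci * (1 + Ci * v))))
   * Cmod (1 - Cexp (t * (2 * PI * Ci * (1 + Ci * v)))) = ray_modulus v t)%R.
Proof.
rewrite Cmod_sqr.
replace (t * (2 * PI * Ci * (1 + Ci * v))) with (- (2 * PI * v * t), 2 * PI * t)%R
  by (apply C_eq; simpl; ring).
set (e := Cexp _).
change (Re (1 - e)) with (1 + - Re e)%R; change (Im (1 - e)) with (0 + - Im e)%R.
unfold e; rewrite Re_Cexp, Im_Cexp; simpl Re; simpl Im.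
assert (H := sin2_cos2 (2 * PI * t)); unfold Rsqr in H.
unfold ray_modulus; set (r := exp _).
replace (r * r)%R with (r * r * (sin (2 * PI * t) * sin (2 * PI * t)
   + cos (2 * PI * t) * cos (2 * PI * t)))%R by (rewrite H; ring).
ring.
Qed.

Lemma ln_Cmod_half (z : C) : z <> 0 -> ln (Cmod z) = (/ 2 * ln (Cmod z * Cmod z))%R.
Proof.
intros Hz; apply Cmod_gt_0 in Hz; rewrite ln_mult by assumption; lra.
Qed.

(** The inner derivative [k exp (t k)] cancels both the prefactor [1 / k] and the denominator in the
    derivative of [L]. The sign of [Re (t * k)] keeps the exponential in the unit disk. *)
Lemma dpath_ray (L : C -> C) (hL : is_dilog L) (k : C) (t : R) :
  k <> 0 -> (Re (t * k) < 0)%R ->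
  dpath (fun s => / k * (L 1 + -1 * L (Cexp (s * k)))) t (Clog (1 - Cexp (t * k))).
Proof.
intros Hk Ht.
assert (Hg : dpath (fun s : R => s * k) t k).
{ apply dpath_ext with (fun s : R => 0 + s * k); [ intros; ring | apply dpath_line ]. }
assert (Hm : (Cmod (Cexp (t * k)) < 1)%R)
  by (rewrite Cmod_Cexp, <- exp_0; now apply exp_increasing).
assert (Hn := Cexp_neq_0 (t * k)).
assert (H := dpath_dilog L hL (fun s => Cexp (s * k)) t _ Hn Hm
  (dpath_Cexp (fun s : R => s * k) t k Hg)).
assert (D := dpath_scal (/ k) _ _ _ (dpath_plus _ _ _ _ _ (dpath_const (L 1) t)
   (dpath_scal (-1) _ _ _ H))).
cbv beta in D.
match type of D with dpath _ _ ?d => replace d with (Clog (1 - Cexp (t * k))) in D end.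
- exact D.
- set (e := Cexp (t * k)) in *; field; split; assumption.
Qed.

(* [t * Re (p (t c)) - t * Re (p z1)] vanishes at the critical point and has
   derivative [ln |1 - exp (2 pi i t c)| - ln |w|], whose sign is that of
   [t - t1]. *)
Lemma ray_segment (L : C -> C) (hL : is_dilog L) (v t1 t : R) (w : C) :
  let k := 2 * PI * Ci * (1 + Ci * v) in
  (0 < v <= 1)%R -> (2.01 < t1 < 2.25)%R -> (2.01 <= t <= 2.49)%R -> t <> t1 ->
  w <> 0 -> (Cmod w < 1)%R -> 1 - Cexp (t1 * k) = w ->
  p L (t1 * (1 + Ci * v)) = Clog w ->
  (Re (Clog w) < Re (p L (t * (1 + Ci * v))))%R.
Proof.
intros k Hv Ht1 Ht Hne Hw0 Hw Hk Hp; assert (HPI := PI_bounds).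
assert (Hvp : (0 < 2 * PI * v)%R) by nra.
assert (Hrk : forall s : R, Re (s * k) = (- (2 * PI * v * s))%R)
  by (intros s; unfold k, Re; simpl; ring).
assert (Hk0 : k <> 0).
{ intros H0; assert (H := Hrk 1%R); rewrite H0 in H; simpl in H; lra. }
set (c := 1 + Ci * v) in *.
assert (Hc0 : c <> 0).
{ intros H0; apply (f_equal Re) in H0; unfold c in H0; simpl in H0; lra. }
set (g := fun s : R => / k * (L 1 + -1 * L (Cexp (s * k)))).
assert (Hpg : forall s : R, (0 < s)%R -> g s = s * p L (s * c)).
{ intros s Hs; unfold g, p.
  replace (2 * PI * Ci * (s * c)) with (s * k) by (unfold k; ring).
  field; split; [ exact Hk0 | ].
  intros H0; apply RtoC_inj in H0; lra. }
set (f := fun s : R => (Re (g s) - s * Re (Clog w))%R).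
set (df := fun s : R => (ln (Cmod (1 - Cexp (s * k))) - ln (Cmod w))%R).
assert (Hf : forall s, (0 < s)%R -> derivable_pt_lim f s (df s)).
{ intros s Hs; apply is_derive_Reals.
  destruct (dpath_ray L hL k s Hk0 ltac:(rewrite Hrk; nra)) as [H _].
  unfold f, df; apply (is_derive_minus (fun s => Re (g s)) (fun s => s * Re (Clog w))%R);
    [ exact H | ].
  auto_derive; trivial; simpl; ring. }
assert (Hf1 : f t1 = 0%R).
{ unfold f; rewrite Hpg, Hp by lra; unfold Re; simpl; ring. }
assert (Hft : (0 < f t -> Re (Clog w) < Re (p L (t * c)))%R).
{ unfold f; rewrite Hpg by lra; rewrite re_scal_l.
  intros H; apply Rmult_lt_reg_l with t; lra. }
apply Hft; clear Hft.
assert (Hw2 : (Cmod w * Cmod w = ray_modulus v t1)%R)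
  by (rewrite <- Hk; apply ray_modulus_eq).
assert (Hwp := proj1 (Cmod_gt_0 w) Hw0).
assert (Hsq : forall s, (0 < s)%R -> 1 - Cexp (s * k) <> 0).
{ intros s Hs H0.
  assert (H : Cexp (s * k) = 1)
    by (replace (Cexp (s * k)) with (1 - (1 - Cexp (s * k))) by ring; rewrite H0; ring).
  apply (f_equal Cmod) in H; rewrite Cmod_Cexp, Hrk, Cmod_1, <- exp_0 in H.
  apply exp_inv in H; nra. }
destruct (Rlt_dec t t1) as [Hlt|Hge].
- destruct (MVT_cor2 f df t t1 Hlt) as [x [Heq Hx]]; [ intros; apply Hf; lra | ].
  assert (df x < 0)%R; [ | nra ].
  unfold df; rewrite (ln_Cmod_half (1 - Cexp (x * k))), (ln_Cmod_half w)
    by (assumption || apply Hsq; lra).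
  assert (Hmx : (ray_modulus v x < ray_modulus v t1)%R)
    by (apply ray_modulus_increasing; lra).
  assert (Hpx := proj1 (Cmod_gt_0 _) (Hsq x ltac:(lra))).
  rewrite Hw2; unfold k at 1 2, c; unfold c in Hpx; rewrite ray_modulus_eq.
  assert (ln (ray_modulus v x) < ln (ray_modulus v t1))%R; [ | lra ].
  apply ln_increasing; trivial.
  rewrite <- ray_modulus_eq; fold c; fold k; apply Rmult_lt_0_compat; exact Hpx.
- destruct (MVT_cor2 f df t1 t ltac:(lra)) as [x [Heq Hx]]; [ intros; apply Hf; lra | ].
  assert (0 < df x)%R; [ | nra ].
  unfold df; rewrite (ln_Cmod_half (1 - Cexp (x * k))), (ln_Cmod_half w)
    by (assumption || apply Hsq; lra).
  assert (Hmx : (ray_modulus v t1 < ray_modulus v x)%R).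
  { destruct (Rle_dec x 2.25) as [Hx1|Hx1]; [ apply ray_modulus_increasing; lra | ].
    apply Rlt_trans with 1%R; [ rewrite <- Hw2; nra | ].
    apply ray_modulus_gt_1; lra. }
  rewrite Hw2; unfold k at 1 2, c; rewrite ray_modulus_eq.
  assert (ln (ray_modulus v t1) < ln (ray_modulus v x))%R; [ | lra ].
  apply ln_increasing; trivial; rewrite <- Hw2; nra.
Qed.

(** * The critical point *)

(** These enclose [z1]; in particular an argument below [PI / 2] is what yields [Re z1 < 2.25]. The
    slope of [1 - w] is large, so [atan] is expanded at its inverse, at most
    [0.0333 / 0.108 < 0.31]. *)
Lemma Clog_one_minus_num (w : C) :
  (0.108 <= - Im w <= 0.12 -> 0 < 1 - Re w <= 0.0333 ->
   0 < - Re (Clog (1 - w)) <= 2.27 /\ PI / 2 - 0.31 <= Im (Clog (1 - w)) < PI / 2)%R.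
Proof.
intros Hi Hr; set (u := 1 - w).
assert (Er : Re u = (1 - Re w)%R) by (unfold u, Re; simpl; ring).
assert (Ei : Im u = (- Im w)%R) by (unfold u, Im; simpl; ring).
rewrite <- Er in Hr; rewrite <- Ei in Hi; clearbody u.
assert (Hm1 : (0.108 <= Cmod u)%R)
  by (apply Rle_trans with (2 := im_le_Cmod u); rewrite Rabs_pos_eq; lra).
assert (Hm2 : (Cmod u <= 0.2)%R) by (apply Cmod_le_of_sqr; nra).
rewrite Clog_atan by lra; simpl Re; simpl Im; split.
- assert (H1 : (/ 0.108 <= exp 2.27)%R).
  { apply Rle_trans with (2 := exp_lower_8 2.27 ltac:(lra)); lra. }
  assert (H2 : (exp (Ropp 2.27) <= 0.108)%R).
  { rewrite exp_Ropp, <- (Rinv_inv 0.108); apply Rinv_le_contravar; lra. }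
  assert (H3 : (ln (exp (Ropp 2.27)) <= ln (Cmod u))%R)
    by (apply ln_le; [ apply exp_pos | lra ]).
  assert (H4 : (ln (Cmod u) < ln 1)%R) by (apply ln_increasing; lra).
  rewrite ln_exp in H3; rewrite ln_1 in H4; lra.
- assert (Hb := atan_bound (Im u / Re u)); split; [ | lra ].
  replace (Im u / Re u)%R with (/ (Re u / Im u))%R by (field; lra).
  assert (Hq : (0 < Re u / Im u <= 0.31)%R).
  { split; [ apply Rdiv_lt_0_compat; lra | ].
    apply Rcomplements.Rle_div_l; lra. }
  rewrite atan_inv by lra.
  assert (atan (Re u / Im u) <= Re u / Im u)%R; [ | lra ].
  set (x := (Re u / Im u)%R) in *; clearbody x.
  assert (0 <= x - atan x)%R; [ | lra ].
  apply (nonneg_of_derive (fun t => t - atan t)%R (fun t => t * t / (1 + t * t))%R).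
  + lra.
  + rewrite atan_0; ring.
  + intros t Ht; auto_derive; trivial; unfold Rsqr; field; nra.
  + intros t Ht; apply Rdiv_le_0_compat; nra.
Qed.

Lemma Cexp_4_pi_i (z : C) : Cexp (4 * PI * Ci + z) = Cexp z.
Proof.
apply C_eq; rewrite ?Re_Cexp, ?Im_Cexp;
  replace (Re (4 * PI * Ci + z)) with (Re z) by (unfold Re; simpl; ring);
  replace (Im (4 * PI * Ci + z)) with (Im z + 2 * INR 2 * PI)%R
    by (unfold Im; simpl; ring); now rewrite ?cos_period, ?sin_period.
Qed.

(* Reflection turns the equation [L w = 4 pi i log w] into
   [L 1 - L (1 - w) = 2 pi i z1 log w]. *)
Lemma p_critical (L : C -> C) (hL : is_dilog L) (w : C) :
  (Cmod w < 1)%R -> (Cmod (1 - w) < 1)%R -> dilog_zero L w ->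
  2 + Clog (1 - w) / (2 * PI * Ci) <> 0 ->
  Cexp (2 * PI * Ci * (2 + Clog (1 - w) / (2 * PI * Ci))) = 1 - w /\
  p L (2 + Clog (1 - w) / (2 * PI * Ci)) = Clog w.
Proof.
intros Hw Hu (_ & Hw0 & Hz) Hz1.
assert (H2 := two_pi_i_neq_0).
assert (Hu0 : 1 - w <> 0).
{ apply Cmod_gt_0; generalize (Cmod_minus_le 1 w); rewrite Cmod_1; lra. }
assert (E : 2 * PI * Ci * (2 + Clog (1 - w) / (2 * PI * Ci)) = 4 * PI * Ci + Clog (1 - w)).
{ replace (RtoC 4) with (2 * 2) by (rewrite <- RtoC_mult; f_equal; ring).
  field; repeat split; intros H0; apply H2; rewrite H0; ring. }
assert (HE : Cexp (2 * PI * Ci * (2 + Clog (1 - w) / (2 * PI * Ci))) = 1 - w)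
  by (rewrite E, Cexp_4_pi_i; now apply Cexp_Clog).
split; trivial; unfold p; rewrite HE.
assert (HN : 4 * PI * Ci + Clog (1 - w) <> 0).
{ rewrite <- E; now apply Cmult_neq_0. }
rewrite E, <- (dilog_reflection L hL w Hw Hu).
replace (L w) with (4 * PI * Ci * Clog w).
- field; exact HN.
- replace (L w) with (L w - 4 * PI * Ci * Clog w + 4 * PI * Ci * Clog w) by ring.
  rewrite Hz; ring.
Qed.

Lemma Re_mult_slope (z : C) :
  Re z <> 0%R -> z = Re z * (1 + Ci * (Im z / Re z)%R).
Proof.
destruct z as [x y]; simpl; intros H; apply C_eq; simpl; field; exact H.
Qed.

Theorem theorem5p8 (Li2 : C -> C) (hLi2 : is_dilog Li2)
    (w : C) (hw : unique (dilog_zero Li2) w) :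
  let z1 : C := 2 + Clog (1 - w) / (2 * PI * Ci) in
  let v : R := (Im z1 / Re z1)%R in
  let c : C := 1 + Ci * v in
  let Q : C -> Prop :=
    polygonal_path [RtoC 2.01; 2.01 * c; 2.49 * c; RtoC 2.49] in
  Q z1 /\
  (forall z : C, Q z -> z <> z1 -> (0 < Re (p Li2 z - p Li2 z1))%R).
Proof.
assert (HPI := PI_bounds).
destruct (dilog_zero_exists Li2 hLi2) as (l & Hl & Hlr & Hli).
destruct hw as [Hzero Huniq].
assert (Hwl := Huniq _ Hl).
destruct (Cexp_num l Hlr Hli) as (Hn1 & Hn2 & Hn3 & Hn4).
assert (HlogW : Clog w = l) by (rewrite Hwl; apply Clog_Cexp; lra).
rewrite <- Hwl in Hn1, Hn2, Hn3, Hn4; clear Hl Huniq Hwl.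
assert (Hu1 : (Cmod (1 - w) < 1)%R).
{ apply Rle_lt_trans with 0.2%R; [ | lra ].
  apply Cmod_le_of_sqr; [ lra | ].
  change (Re (1 - w)) with (1 + - Re w)%R; change (Im (1 - w)) with (0 + - Im w)%R; nra. }
destruct (Clog_one_minus_num w Hn1 Hn3) as [Hlu1 Hlu2].
intros z1 v c Q.
assert (Er : Re z1 = (2 + Im (Clog (1 - w)) / (2 * PI))%R).
{ unfold z1; set (a := Clog (1 - w)); replace (a / (2 * PI * Ci))
    with (Im a / (2 * PI), - Re a / (2 * PI))%R; [ reflexivity | ].
  apply C_eq; unfold Re, Im; simpl; field; repeat split; nra. }
assert (Ei : Im z1 = (- Re (Clog (1 - w)) / (2 * PI))%R).
{ unfold z1; set (a := Clog (1 - w)); replace (a / (2 * PI * Ci))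
    with (Im a / (2 * PI), - Re a / (2 * PI))%R; [ unfold Im; simpl; ring | ].
  apply C_eq; unfold Re, Im; simpl; field; repeat split; nra. }
assert (Hre : (2.195 <= Re z1 < 2.25)%R).
{ rewrite Er; split.
  - assert (0.195 <= Im (Clog (1 - w)) / (2 * PI))%R; [ | lra ].
    apply (Rcomplements.Rle_div_r 0.195 (Im (Clog (1 - w))) (2 * PI)); lra.
  - assert (Im (Clog (1 - w)) / (2 * PI) < 0.25)%R; [ | lra ].
    apply Rcomplements.Rlt_div_l; lra. }
assert (Him : (0 < Im z1 <= 0.362)%R).
{ rewrite Ei; split.
  - apply Rdiv_lt_0_compat; lra.
  - apply Rcomplements.Rle_div_l; lra. }
(* Consequently the heights [2.01 v] and [2.49 v] of the vertical sides are below 0.332 and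
   0.411. *)
assert (Hv : (0 < v <= 0.165)%R).
{ unfold v; split; [ apply Rdiv_lt_0_compat; lra | ].
  apply Rcomplements.Rle_div_l; lra. }
assert (Hzc : z1 = Re z1 * c).
{ apply Re_mult_slope; lra. }
destruct (p_critical Li2 hLi2 w Hn4 Hu1 Hzero) as [HE Hp].
{ fold z1; intros H0; rewrite H0 in Hre; simpl in Hre; lra. }
fold z1 in HE, Hp.
assert (HP : Re (p Li2 z1) = Re l) by (rewrite Hp, HlogW; reflexivity).
split.
(* [z1 = Re z1 * c] lies on the middle side, whose parameter along [c] runs over an interval of
   length [0.48 = 2.49 - 2.01]. *)
- right; left; exists ((Re z1 - 2.01) / 0.48)%R; split.
  + split; [ apply Rdiv_le_0_compat; lra | apply Rcomplements.Rle_div_l; lra ].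
  + replace (2.01 * c + ((Re z1 - 2.01) / 0.48)%R * (2.49 * c - 2.01 * c)) with
      (RtoC (2.01 + (Re z1 - 2.01) / 0.48 * (2.49 - 2.01)) * c)
      by (rewrite RtoC_plus, RtoC_mult, !RtoC_minus; ring).
    rewrite Hzc at 1; do 2 f_equal; lra.
- assert (Hgoal : forall z : C, (Re l < Re (p Li2 z) -> 0 < Re (p Li2 z - p Li2 z1))%R).
  { intros z Hz.
    change (Re (p Li2 z - p Li2 z1)) with (Re (p Li2 z) - Re (p Li2 z1))%R; lra. }
  assert (Hvert : forall s x : R, RtoC x + s * (x * c - x) = (x, x * v * s)%R).
  { intros s x; apply C_eq; unfold c; simpl; ring. }
  assert (Hvert' : forall s x : R, x * c + s * (x - x * c) = (x, x * v * (1 - s))%R).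
  { intros s x; apply C_eq; unfold c; simpl; ring. }
  intros z [H|[H|[H|H]]] Hne; apply Hgoal.
  + destruct H as [s [Hs ->]]; rewrite Hvert.
    apply left_segment; trivial; [ | lra ].
    split; [ apply Rmult_le_pos; lra | ].
    apply Rle_trans with (2.01 * 0.165 * 1)%R; [ | lra ].
    apply Rmult_le_compat; lra.
  + destruct H as [s [Hs Hz]].
    set (t := (2.01 + s * 0.48)%R).
    assert (Ht : z = t * c).
    { rewrite Hz; replace (2.01 * c + s * (2.49 * c - 2.01 * c)) with
        (RtoC (2.01 + s * (2.49 - 2.01)) * c)
        by (rewrite RtoC_plus, RtoC_mult, !RtoC_minus; ring).
      do 2 f_equal; unfold t; lra. }
    rewrite Ht, <- HlogW.
    apply (ray_segment Li2 hLi2 v (Re z1)); try (unfold t; lra).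
    * intros H0; apply Hne; rewrite Ht, Hzc, H0; reflexivity.
    * exact (proj1 (proj2 Hzero)).
    * replace (Re z1 * (2 * PI * Ci * (1 + Ci * v))) with (2 * PI * Ci * (Re z1 * c))
        by (unfold c; ring).
      rewrite <- Hzc, HE; ring.
    * fold c; rewrite <- Hzc; exact Hp.
  + destruct H as [s [Hs ->]]; rewrite Hvert'.
    apply right_segment; trivial; [ | lra ].
    split; [ apply Rmult_le_pos; lra | ].
    apply Rle_trans with (2.49 * 0.165 * 1)%R; [ | lra ].
    apply Rmult_le_compat; lra.
  (* The last clause of [polygonal_path] is the end point 2.49 itself, the case [y = 0] of the right
     side. *)
  + simpl in H; rewrite H.
    apply (right_segment Li2 hLi2 0); lra.
Qed.
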